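(* Let $n\ge 2$. The set $\mathrm{SDT}(-\infty)$ of dual marginally large semistandard decomposition tableaux for $\mathfrak{q}(n)$, together with the operators $e_i,f_i$ ($i\in I$) on it defined in the context, is an abstract $\mathfrak{q}(n)$-crystal such that $$\mathrm{SDT}(-\infty)\;\cong\;\varinjlim_{\lambda\in\Lambda^-}\mathrm{SDT}(\lambda)\otimes\mathcal{T}_{-\lambda},$$ where the direct limit is taken along the crystal embeddings $\upsilon_{\lambda,\lambda+\mu}$ ($\lambda,\mu\in\Lambda^-$) described in the context.
   Context: **Notation.** $I_0=\{1,\dots,n-1\}$, $I=I_0\sqcup\{\overline1\}$; $\epsilon_1,\dots,\epsilon_n$ is the standard basis of $\mathbb{Z}^n$; $\alpha_i=\epsilon_i-\epsilon_{i+1}$ for $i\in I_0$. $\Lambda^-$ is the set of $\lambda=-\lambda_1\epsilon_1-\cdots-\lambda_n\epsilon_n\in\mathbb Z^n_{\le0}$ such that for $1\le i\le n-1$, $\lambda_i\ge\lambda_{i+1}$, and $\lambda_i=\lambda_{i+1}$ implies $\lambda_i=\lambda_{i+1}=0$. It is partially ordered by $\lambda\le\mu$ iff $\mu-\lambda\in\Lambda^-$. An element $\lambda\in\Lambda^-$ is identified with the strict partition $w_0\lambda=(\lambda_n,\dots,\lambda_1)$; $\ell(\lambda)$ is the number of nonzero $\lambda_i$. **Crystals.** An abstract $\mathfrak{gl}(n)$-crystal is a set $\mathcal B$ with maps $e_i,f_i:\mathcal B\to\mathcal B\sqcup\{\mathbf 0\}$, $\varepsilon_i,\varphi_i:\mathcal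 B\to\mathbb Z\sqcup\{-\infty\}$ ($i\in I_0$) and $\mathrm{wt}:\mathcal B\to\mathbb Z^n$ such that, for $i\in I_0$ and $b,b'\in\mathcal B$: $\mathrm{wt}(e_ib)=\mathrm{wt}(b)+\alpha_i$ if $e_ib\ne\mathbf 0$; $\mathrm{wt}(f_ib)=\mathrm{wt}(b)-\alpha_i$ if $f_ib\neq\mathbf 0$; $\varphi_i(b)=\varepsilon_i(b)+\mathrm{wt}_i(b)$, where $\mathrm{wt}_i(b)=\mu_i-\mu_{i+1}$ if $\mathrm{wt}(b)=\sum_j\mu_j\epsilon_j$; $f_ib=b'$ iff $b=e_ib'$; if $e_ib\ne\mathbf 0$ then $\varepsilon_i(e_ib)=\varepsilon_i(b)-1$ and $\varphi_i(e_ib)=\varphi_i(b)+1$; if $f_ib\ne\mathbf 0$ then $\varepsilon_i(f_ib)=\varepsilon_i(b)+1$ and $\varphi_i(f_ib)=\varphi_i(b)-1$; if $\varphi_i(b)=-\infty$ then $e_ib=f_ib=\mathbf 0$. An abstract $\mathfrak q(n)$-crystal is an abstract $\mathfrak{gl}(n)$-crystal $\mathcal B$ with further maps $e_{\overline1},f_{\overline1}:\mathcal B\to\mathcal B\sqcup\{\mathbf 0\}$ such that: $\mathrm{wt}(\mathcal B)\subset\mathbb Z^n_{\ge0}$; $\mathrm{wt}(e_{\overline1}b)=\mathrm{wt}(b)+\alpha_1$ if $e_{\overline1}b\ne\mathbf0$; $\mathrm{wt}(f_{\overline1}b)=\mathrm{wt}(b)-\alpha_1$ if $f_{\overline1}b\neq\mathbf0$;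 $f_{\overline1}b=b'$ iff $b=e_{\overline1}b'$ for $b,b'\in\mathcal B$; and for $3\le i\le n-1$, $e_{\overline1},f_{\overline1}$ commute with $e_i,f_i$, and $\varepsilon_i(e_{\overline1}b)=\varepsilon_i(b)$, $\varphi_i(e_{\overline1}b)=\varphi_i(b)$ whenever $e_{\overline1}b\in\mathcal B$. A crystal morphism is a map $\psi:\mathcal B\to\mathcal C\sqcup\{\mathbf0\}$ (with $\psi(\mathbf 0)=\mathbf 0$) such that if $b\in\mathcal B$ and $\psi(b)\in\mathcal C$ it preserves $\mathrm{wt},\varepsilon_i,\varphi_i$ ($i\in I_0$), and for all $i\in I$: $\psi(e_ib)=e_i\psi(b)$ provided $\psi(e_ib)\ne\mathbf0$ and $e_i\psi(b)\ne\mathbf0$, and likewise for $f_i$. It is an embedding (isomorphism) if the induced map $\mathcal B\sqcup\{\mathbf0\}\to\mathcal C\sqcup\{\mathbf0\}$ is injective (bijective). **Tensor products.** $\mathcal B\otimes\mathcal C$ is $\mathcal B\times\mathcal C$ with, for $i\in I_0$: $e_i(b\otimes c)=e_ib\otimes c$ if $\varphi_i(c)<\varepsilon_i(b)$, and $b\otimes e_ic$ otherwise; $f_i(b\otimes c)=f_ib\otimes c$ if $\varphi_i(c)\le\varepsilon_i(b)$, and $b\otimes f_ic$ otherwise; $e_{\overline1}(b\otimes c)=b\otimes e_{\overline1}c$ if $e_{\overline1}b=f_{\overline1}b=\mathbf0$, and $e_{\overline1}b\otimes c$ otherwise; $f_{\overline1}(b\otimes c)=b\otimes f_{\overline1}c$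 if $e_{\overline1}b=f_{\overline1}b=\mathbf0$, and $f_{\overline1}b\otimes c$ otherwise; $\varepsilon_i(b\otimes c)=\max(\varepsilon_i(c),\varepsilon_i(b)-\mathrm{wt}_i(c))$, $\varphi_i(b\otimes c)=\max(\varphi_i(b),\varphi_i(c)+\mathrm{wt}_i(b))$, $\mathrm{wt}(b\otimes c)=\mathrm{wt}(b)+\mathrm{wt}(c)$. (Tensors with a factor $\mathbf 0$ are $\mathbf 0$.) For $\nu\in\mathbb Z^n$, $\mathcal T_\nu=\{t_\nu\}$ with $e_it_\nu=f_it_\nu=\mathbf0$ for all $i\in I$, $\varepsilon_i(t_\nu)=\varphi_i(t_\nu)=-\infty$ for $i\in I_0$, and $\mathrm{wt}(t_\nu)=\nu$. **Tableaux.** A word $u_1\cdots u_N$ is a hook word if $u_1\ge\cdots\ge u_k<u_{k+1}<\cdots<u_N$ for some $1\le k\le N$. For $\lambda\in\Lambda^-$, consider the shifted Young diagram whose $k$-th row from the top has $\lambda_k$ cells and is shifted $k-1$ units to the right (the shape $w_0\lambda$). $\mathrm{SDT}(\lambda)$ is the set of semistandard decomposition tableaux of this shape: fillings with letters in $\{1,\dots,n\}$ such that, with $v_k$ the word formed by reading the $k$-th row (from the top) left to right, each $v_k$ is a hook word, and $v_k$ is a hook subword of maximal length in $v_{k+1}v_k$ for $1\le k\le\ell(\lambda)-1$, where the entries of $v_k$ are taken consecutively. Rows are counted from the top unless said otherwise. $\mathrm{rd}(T)$ is the word obtained by reading each row from right to left, starting with the top row; $\mathrm{rd}_i(T)$ is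 its subword consisting of the letters $i,i+1$; $\overline{\mathrm{rd}}_i(T)$ is obtained from it by successively removing all pairs $(i+1,i)$ (in that order), so it consists of $i$'s followed by $(i+1)$'s. $L^\lambda\in\mathrm{SDT}(\lambda)$ is the tableau whose $i$-th row from the bottom contains only the letter $i$. Crystal structure on $\mathrm{SDT}(\lambda)$: for $i\in I_0$, $e_iT$ changes to $i$ the box of the leftmost $i+1$ of $\overline{\mathrm{rd}}_i(T)$ ($\mathbf0$ if none); $f_iT$ changes to $i+1$ the box of the rightmost $i$ of $\overline{\mathrm{rd}}_i(T)$ ($\mathbf 0$ if none). If the leftmost letter of $\mathrm{rd}_1(T)$ is $1$, then $e_{\overline1}T=\mathbf0$ and $f_{\overline1}T$ changes that box to $2$; if it is $2$, then $f_{\overline1}T=\mathbf0$ and $e_{\overline1}T$ changes that box to $1$; if $\mathrm{rd}_1(T)$ is empty, both are $\mathbf0$. $\varepsilon_i(T)$ and $\varphi_i(T)$ are the numbers of $(i+1)$'s and of $i$'s in $\overline{\mathrm{rd}}_i(T)$; $\mathrm{wt}(T)=\sum_j(\#j\text{ in }T)\epsilon_j$. **Directed system and limit.** For $\lambda,\mu\in\Lambda^-$, $\upsilon_{\lambda,\lambda+\mu}:\mathrm{SDT}(\lambda)\otimes\mathcal T_{-\lambda}\hookrightarrow\mathrm{SDT}(\lambda+\mu)\otimes\mathcal T_{-\lambda-\mu}$ is the $\mathfrak q(n)$-crystal embedding $T\otimes t_{-\lambda}\mapsto E(T)\otimes t_{-\lambda-\mu}$, where $E(T)$ is obtained from $T$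 by adding $\mu_{n+1-i}$ boxes with entry $i$ on the left of row $n+1-i$, for each $1\le i\le n$; it sends $L^\lambda\otimes t_{-\lambda}$ to $L^{\lambda+\mu}\otimes t_{-\lambda-\mu}$. The direct limit $\vec{\mathcal B}$ of a directed system of crystals $\{\mathcal B_j\}$, with canonical maps $\psi_j:\mathcal B_j\to\vec{\mathcal B}$, has crystal structure: $e_i\vec b=\psi_j(e_ib_j)$ if some $b_j\in\mathcal B_j$ has $\psi_j(b_j)=\vec b$ and $e_ib_j\ne\mathbf0$, and $e_i\vec b=\mathbf0$ otherwise; similarly for $f_i$; $\mathrm{wt},\varepsilon_i,\varphi_i$ are induced from the $\mathcal B_j$. **The set $\mathrm{SDT}(-\infty)$.** A semistandard decomposition tableau $T$ for $\mathfrak q(n)$ is dual marginally large if it has $n$ rows and, for all $1\le i\le n$, the number of leftmost $i$-boxes in row $n-i+1$ (the initial run of $i$'s) is greater than the total number of boxes in row $n-i+2$ by exactly one (row $n+1$ is empty). $\mathrm{SDT}(-\infty)$ is the set of these. Operators for $T\in\mathrm{SDT}(-\infty)$ and $i\in I_0$: let $T'$ be obtained from $T$ by changing to $i$ the box of the leftmost $i+1$ of $\overline{\mathrm{rd}}_i(T)$; if $T'$ is dual marginally large then $e_iT=T'$; otherwise $e_iT$ is obtained from $T'$ by adding an $(n-k+1)$-box (at the left) in row $k$ for each $1\le k\le n-i$. If there is no $i$ in $\overline{\mathrm{rd}}_i(T)$ then $f_iT=\mathbf0$; otherwise let $T'$ be obtained by changing to $i+1$ the box of the rightmost $i$ of $\overline{\mathrm{rd}}_i(T)$;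 if $T'$ is dual marginally large then $f_iT=T'$; otherwise $f_iT$ is obtained from $T'$ by removing an $(n-k+1)$-box (at the left) in row $k$ for each $1\le k\le n-i$. The operators $e_{\overline1},f_{\overline1}$ are defined exactly as on $\mathrm{SDT}(\lambda)$, except that dual marginal largeness is restored in the same way (with $i=1$ in the range of $k$). The functions $\mathrm{wt},\varepsilon_i,\varphi_i$ on $\mathrm{SDT}(-\infty)$ are those for which the map sending $T$ of shape $w_0\lambda$ to the class of $T\otimes t_{-\lambda}$ in the direct limit preserves them.
   Formalization: The axiom that weights lie in Z^n_{≥0} is dropped from ''abstract q(n)-crystal'': it fails for SDT(-∞), e.g. n=2, e_1 of the tableau (2,2),(1) has weight (1,-1). In T_{-λ}, λ is read as (λ_n,…,λ_1), so that the embeddings preserve weight. *)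

(* Defs.v *)
From mathcomp Require Import all_boot all_order all_algebra.
From mathcomp Require Import boolp classical_sets functions.
Set Implicit Arguments.
Unset Strict Implicit.
Unset Printing Implicit Defensive.
Import Order.TTheory GRing.Theory Num.Theory.
Local Open Scope classical_set_scope.
Local Open Scope ring_scope.

(** * Weights and indices

    Letters, rows, coordinates of Z^n and elements of I_0 are all numbered
    from 1, as on paper. *)

(* the j-th coordinate of mu, for 1 <= j <= n *)
Definition coord n (mu : 'rV[int]_n) (j : nat) : int :=
  \sum_(k < n | k.+1 == j) mu 0 k.

Definition epsv n (j : nat) : 'rV[int]_n := \row_(k < n) (k.+1 == j)%:R.

Definition alpha n (i : nat) : 'rV[int]_n := epsv n i - epsv n i.+1.

(* I_0 = {1, ..., n-1} *)
Record I0 (n : nat) := MkI0 { idx :> nat; idx_bounds : (0 < idx < n)%N }.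

(* I = I_0 + {\bar 1}; [None] is \bar 1 *)
Definition Iq (n : nat) := option (I0 n).

(* Z + {-oo}; [None] is -oo *)
Definition zinf := option int.

Definition zadd (x : zinf) (z : int) : zinf := omap (fun y => y + z) x.

Definition zmax (x y : zinf) : zinf :=
  match x, y with
  | None, _ => y
  | _, None => x
  | Some a, Some b => Some (Num.max a b)
  end.

Definition zlt (x y : zinf) : bool :=
  match x, y with
  | _, None => false
  | None, Some _ => true
  | Some a, Some b => a < b
  end.

Definition zle (x y : zinf) : bool := ~~ zlt y x.

(** * Crystals

    The underlying set of a crystal is a set [elts] of elements of an ambient
    type [car].  The maps are given on [car] and matter only on [elts]; that
    e_i and f_i take values in [elts] and 0 is one of the crystal axioms below.
    The element 0 is [None]. *)
Record crystal (n : nat) := Crystal {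
  car  : Type;
  elts : set car;
  wt   : car -> 'rV[int]_n;
  eps  : I0 n -> car -> zinf;
  phi  : I0 n -> car -> zinf;
  eop  : Iq n -> car -> option car;
  fop  : Iq n -> car -> option car
}.
Arguments elts {n} c.
Arguments wt {n} c _.
Arguments eps {n} c _ _.
Arguments phi {n} c _ _.
Arguments eop {n} c _ _.
Arguments fop {n} c _ _.

Definition wti n (B : crystal n) (i : I0 n) (b : car B) : int :=
  coord (wt B b) i - coord (wt B b) i.+1.

Record is_gl_crystal n (B : crystal n) : Prop := {
  gl_e_closed : forall (i : I0 n) b b', elts B b ->
    eop B (Some i) b = Some b' -> elts B b';
  gl_f_closed : forall (i : I0 n) b b', elts B b ->
    fop B (Some i) b = Some b' -> elts B b';
  gl_wt_e : forall (i : I0 n) b b', elts B b ->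
    eop B (Some i) b = Some b' -> wt B b' = wt B b + alpha n i;
  gl_wt_f : forall (i : I0 n) b b', elts B b ->
    fop B (Some i) b = Some b' -> wt B b' = wt B b - alpha n i;
  gl_phi : forall (i : I0 n) b, elts B b ->
    phi B i b = zadd (eps B i b) (wti i b);
  gl_fe : forall (i : I0 n) b b', elts B b -> elts B b' ->
    (fop B (Some i) b = Some b' <-> eop B (Some i) b' = Some b);
  gl_eps_e : forall (i : I0 n) b b', elts B b ->
    eop B (Some i) b = Some b' ->
    eps B i b' = zadd (eps B i b) (- 1) /\ phi B i b' = zadd (phi B i b) 1;
  gl_eps_f : forall (i : I0 n) b b', elts B b ->
    fop B (Some i) b = Some b' ->
    eps B i b' = zadd (eps B i b) 1 /\ phi B i b' = zadd (phi B i b) (- 1);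
  gl_phi_ninf : forall (i : I0 n) b, elts B b ->
    phi B i b = None -> eop B (Some i) b = None /\ fop B (Some i) b = None
}.

(* Weights range over Z^n: the condition wt(B) in (Z_{>= 0})^n, which is part of
   the definition for crystals of polynomial representations, fails for T_nu,
   for SDT(lambda) (x) T_{-lambda} and for their direct limit, and is not
   imposed. *)
Record is_q_crystal n (B : crystal n) : Prop := {
  q_gl : is_gl_crystal B;
  q_e_closed : forall b b', elts B b -> eop B None b = Some b' -> elts B b';
  q_f_closed : forall b b', elts B b -> fop B None b = Some b' -> elts B b';
  q_wt_e : forall b b', elts B b ->
    eop B None b = Some b' -> wt B b' = wt B b + alpha n 1;
  q_wt_f : forall b b', elts B b ->
    fop B None b = Some b' -> wt B b' = wt B b - alpha n 1;
  q_fe : forall b b', elts B b -> elts B b' ->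
    (fop B None b = Some b' <-> eop B None b' = Some b);
  q_comm : forall (i : I0 n) b, (3 <= i)%N -> elts B b ->
    [/\ obind (eop B None) (eop B (Some i) b) = obind (eop B (Some i)) (eop B None b),
        obind (eop B None) (fop B (Some i) b) = obind (fop B (Some i)) (eop B None b),
        obind (fop B None) (eop B (Some i) b) = obind (eop B (Some i)) (fop B None b) &
        obind (fop B None) (fop B (Some i) b) = obind (fop B (Some i)) (fop B None b)];
  q_eps : forall (i : I0 n) b b', (3 <= i)%N -> elts B b ->
    eop B None b = Some b' -> eps B i b' = eps B i b /\ phi B i b' = phi B i b
}.

(* the pointed set B + {0} *)
Definition pointed n (B : crystal n) : set (option (car B)) :=
  [set x | if x is Some b then elts B b else True].

Record is_morphism n (B C : crystal n) (psi : car B -> option (car C)) : Prop := {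
  mor_into : forall b, elts B b -> pointed (psi b);
  mor_wt : forall b c, elts B b -> psi b = Some c -> wt C c = wt B b;
  mor_eps : forall (i : I0 n) b c, elts B b -> psi b = Some c ->
    eps C i c = eps B i b /\ phi C i c = phi B i b;
  mor_e : forall (i : Iq n) b c, elts B b -> psi b = Some c ->
    obind psi (eop B i b) <> None -> eop C i c <> None ->
    obind psi (eop B i b) = eop C i c;
  mor_f : forall (i : Iq n) b c, elts B b -> psi b = Some c ->
    obind psi (fop B i b) <> None -> fop C i c <> None ->
    obind psi (fop B i b) = fop C i c
}.

Definition is_isomorphism n (B C : crystal n) (psi : car B -> option (car C)) :=
  is_morphism psi /\ set_bij (@pointed n B) (@pointed n C) (obind psi).

Definition isomorphic n (B C : crystal n) : Prop :=
  exists psi : car B -> option (car C), is_isomorphism psi.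

(** * Tensor products and the crystals T_nu *)

Definition tensor n (B C : crystal n) : crystal n :=
  let e_l i b c := omap (fun b' => (b', c)) (eop B i b) in
  let e_r i b c := omap (fun c' => (b, c')) (eop C i c) in
  let f_l i b c := omap (fun b' => (b', c)) (fop B i b) in
  let f_r i b c := omap (fun c' => (b, c')) (fop C i c) in
  @Crystal n (car B * car C)%type
    (elts B `*` elts C)
    (fun x => wt B x.1 + wt C x.2)
    (fun i x => zmax (eps C i x.2) (zadd (eps B i x.1) (- wti i x.2)))
    (fun i x => zmax (phi B i x.1) (zadd (phi C i x.2) (wti i x.1)))
    (fun i x => let: (b, c) := x in
       match i with
       | Some j => if zlt (phi C j c) (eps B j b) then e_l i b c else e_r i b c
       | None => if ~~ isSome (eop B i b) && ~~ isSome (fop B i b)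
                 then e_r i b c else e_l i b c
       end)
    (fun i x => let: (b, c) := x in
       match i with
       | Some j => if zle (phi C j c) (eps B j b) then f_l i b c else f_r i b c
       | None => if ~~ isSome (eop B i b) && ~~ isSome (fop B i b)
                 then f_r i b c else f_l i b c
       end).

Definition Tcrystal n (nu : 'rV[int]_n) : crystal n :=
  @Crystal n unit setT (fun _ => nu) (fun _ _ => None) (fun _ _ => None)
    (fun _ _ => None) (fun _ _ => None).

(** * Direct limits *)

Record dsystem (n : nat) := DSystem {
  ds_idx : Type;
  ds_le  : ds_idx -> ds_idx -> Prop;
  ds_obj : ds_idx -> crystal n;
  ds_map : forall i j, ds_le i j -> car (ds_obj i) -> car (ds_obj j)
}.

Section DirectLimit.
Variables (n : nat) (D : dsystem n).

Let el := {j : ds_idx D & car (ds_obj j)}.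

(* psi_j(b) is the class of b: all the elements that have the same image as b
   somewhere in the system *)
Definition dl_psi (j : ds_idx D) (b : car (ds_obj j)) : set el :=
  [set x : el | elts (ds_obj (tag x)) (tagged x) /\
     exists m (h : ds_le (tag x) m) (h' : ds_le j m),
       ds_map h (tagged x) = ds_map h' b].

(* an induced function or operator is read off any representative satisfying
   the required condition; [xget] returns its first argument if there is none *)
Definition dl_fun (T : choiceType) (dflt : T)
    (F : forall j, car (ds_obj j) -> T) (C : set el) : T :=
  xget dflt [set v | exists j (b : car (@ds_obj n D j)),
    [/\ elts (ds_obj j) b, dl_psi b = C & v = F j b]].

Definition dl_op (F : forall j, car (ds_obj j) -> option (car (ds_obj j)))
    (C : set el) : option (set el) :=
  xget None [set v | exists j (b b' : car (@ds_obj n D j)),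
    [/\ elts (ds_obj j) b, dl_psi b = C, F j b = Some b' &
        v = Some (dl_psi b')]].

Definition direct_limit : crystal n :=
  @Crystal n (set el)
    [set C | exists j (b : car (@ds_obj n D j)),
       elts (ds_obj j) b /\ C = dl_psi b]
    (dl_fun 0 (fun j => wt (ds_obj j)))
    (fun i => dl_fun None (fun j => eps (ds_obj j) i))
    (fun i => dl_fun None (fun j => phi (ds_obj j) i))
    (fun i => dl_op (fun j => eop (ds_obj j) i))
    (fun i => dl_op (fun j => fop (ds_obj j) i)).

End DirectLimit.

(** * Tableaux

    A filling is the list of its n rows from the top, each row the list of its
    entries from left to right; rows may be empty.  The horizontal shift of the
    rows of the shifted diagram plays no role in any of the definitions and is
    not recorded. *)

Definition filling := seq (seq nat).

(* the k-th row from the top, k >= 1; [trow T n.+1] is empty *)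
Definition trow (T : filling) (k : nat) : seq nat := nth [::] T k.-1.

(* Lambda^-, whose elements are the vectors - \sum_k lambda_k epsilon_k;
   [part la k] is lambda_k, the length of the k-th row from the top *)
Definition part n (la : 'rV[int]_n) (k : nat) : nat := `|coord la k|%N.

Definition Lam n : set 'rV[int]_n :=
  [set la : 'rV[int]_n | (forall k : 'I_n, la 0 k <= 0) /\
     forall k : nat, (0 < k < n)%N ->
       (part la k.+1 <= part la k)%N /\
       (part la k = part la k.+1 -> part la k = 0%N /\ part la k.+1 = 0%N)].

(* w_0 lambda, read as the vector (lambda_n, ..., lambda_1) of nonnegative
   integers, which is the weight of L^lambda *)
Definition w0 n (la : 'rV[int]_n) : 'rV[int]_n :=
  \row_(j < n) (part la (n - j))%:Z.

Definition ell n (la : 'rV[int]_n) : nat := #|[set k : 'I_n | la 0 k != 0]%SET|.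

(* u_1 >= ... >= u_k < u_{k+1} < ... < u_N for some 1 <= k <= N *)
Definition hook_word (u : seq nat) : bool :=
  has (fun k => sorted geq (take k u) && sorted ltn (drop k.-1 u))
    (iota 1 (size u)).

Definition is_SDT n (la : 'rV[int]_n) (T : filling) : Prop :=
  [/\ size T = n /\ (forall k, (0 < k <= n)%N -> size (trow T k) = part la k),
      forall k a, (0 < k <= n)%N -> a \in trow T k -> (0 < a <= n)%N,
      forall k, (0 < k <= ell la)%N -> hook_word (trow T k) &
      forall k, (0 < k < ell la)%N -> forall u : seq nat,
        subseq u (trow T k.+1 ++ trow T k) -> hook_word u ->
        (size u <= size (trow T k))%N].

(* boxes are pairs (row, column), here numbered from 0 *)
Definition box := (nat * nat)%type.

Definition entry (T : filling) (b : box) : nat := nth 0%N (nth [::] T b.1) b.2.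

Definition set_entry (T : filling) (b : box) (a : nat) : filling :=
  set_nth [::] T b.1 (set_nth 0%N (nth [::] T b.1) b.2 a).

(* the boxes in the order of rd: rows from right to left, from the top *)
Definition rd_boxes (T : filling) : seq box :=
  flatten [seq [seq (r, c) | c <- rev (iota 0 (size (nth [::] T r)))]
          | r <- iota 0 (size T)].

Definition rd (T : filling) : seq nat := map (entry T) (rd_boxes T).

(* rd_i(T), with the boxes that the letters come from *)
Definition rd_i (i : nat) (T : filling) : seq box :=
  [seq b <- rd_boxes T | (entry T b == i) || (entry T b == i.+1)].

(* \bar{rd}_i(T): scanning from the right, every i+1 cancels the leftmost
   letter i that remains on its right, if any *)
Definition rdbar_i (i : nat) (T : filling) : seq box :=
  foldr (fun b w =>
    if w is b' :: w' then
      if (entry T b == i.+1) && (entry T b' == i) then w' else b :: w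
    else [:: b]) [::] (rd_i i T).

Definition change_e (i : nat) (T : filling) : option filling :=
  omap (fun b => set_entry T b i)
    (ohead [seq b <- rdbar_i i T | entry T b == i.+1]).

Definition change_f (i : nat) (T : filling) : option filling :=
  omap (fun b => set_entry T b i.+1)
    (ohead (rev [seq b <- rdbar_i i T | entry T b == i])).

Definition change_e1bar (T : filling) : option filling :=
  if rd_i 1 T is b :: _ then
    if entry T b == 2 then Some (set_entry T b 1) else None
  else None.

Definition change_f1bar (T : filling) : option filling :=
  if rd_i 1 T is b :: _ then
    if entry T b == 1 then Some (set_entry T b 2) else None
  else None.

Definition sdt_e n (i : Iq n) : filling -> option filling :=
  if i is Some j then change_e j else change_e1bar.

Definition sdt_f n (i : Iq n) : filling -> option filling :=
  if i is Some j then change_f j else change_f1bar.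

Definition sdt_wt n (T : filling) : 'rV[int]_n :=
  \row_(j < n) (count_mem j.+1 (rd T))%:Z.

Definition sdt_eps n (i : I0 n) (T : filling) : zinf :=
  Some (count (fun b => entry T b == i.+1) (rdbar_i i T))%:Z.

Definition sdt_phi n (i : I0 n) (T : filling) : zinf :=
  Some (count (fun b => entry T b == i) (rdbar_i i T))%:Z.

Definition SDT n (la : 'rV[int]_n) : crystal n :=
  @Crystal n filling [set T | is_SDT la T] (@sdt_wt n) (@sdt_eps n)
    (@sdt_phi n) (@sdt_e n) (@sdt_f n).

(** * The directed system *)

(* add m_k boxes with entry n+1-k on the left of row k, for 1 <= k <= n *)
Definition add_left (n : nat) (m : nat -> nat) (T : filling) : filling :=
  [seq nseq (m k) (n.+1 - k)%N ++ trow T k | k <- iota 1 n].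

(* remove m_k boxes on the left of row k, for 1 <= k <= n *)
Definition remove_left (n : nat) (m : nat -> nat) (T : filling) : filling :=
  [seq drop (m k) (trow T k) | k <- iota 1 n].

(* SDT(lambda) (x) T_{-lambda}.  In T_{-lambda}, lambda stands for the vector
   (lambda_n, ..., lambda_1) it is identified with: this makes the weight of
   L^lambda (x) t_{-lambda} equal to 0 for all lambda, so that the maps
   [upsilon] preserve weights. *)
Definition SDT_twist n (la : 'rV[int]_n) : crystal n :=
  tensor (SDT la) (Tcrystal (- w0 la)).

Definition Lam_t n := {la : 'rV[int]_n | Lam la}.

Definition Lam_le n (la ka : Lam_t n) : Prop := Lam (sval ka - sval la).

(* upsilon_{lambda, kappa} with kappa = lambda + mu *)
Definition upsilon n (la ka : Lam_t n) (_ : Lam_le la ka)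
    (x : car (SDT_twist (sval la))) : car (SDT_twist (sval ka)) :=
  (add_left n (part (sval ka - sval la)) x.1, x.2).

Definition SDT_system n : dsystem n :=
  @DSystem n (Lam_t n) (@Lam_le n) (fun la => SDT_twist (sval la)) (@upsilon n).

(** * Dual marginally large tableaux *)

(* the length of the initial run of i's *)
Definition run (i : nat) (u : seq nat) : nat := find (predC (pred1 i)) u.

Definition dual_marginally_large (n : nat) (T : filling) : bool :=
  (size T == n) &&
  all (fun i => run i (trow T (n - i).+1) == (size (trow T (n - i).+2)).+1)
    (iota 1 n).

(* the vector of Lambda^- whose parts are the row lengths of T *)
Definition sdt_shape n (T : filling) : 'rV[int]_n :=
  \row_(k < n) (- (size (trow T k.+1))%:Z).

(* add to (remove from) each row k <= n - i one box, with entry n - k + 1,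
   unless T is already dual marginally large *)
Definition restore_e (n i : nat) (T : filling) : filling :=
  if dual_marginally_large n T then T
  else add_left n (fun k => (k <= n - i)%N) T.

Definition restore_f (n i : nat) (T : filling) : filling :=
  if dual_marginally_large n T then T
  else remove_left n (fun k => (k <= n - i)%N) T.

Definition inf_e n (i : Iq n) (T : filling) : option filling :=
  omap (restore_e n (if i is Some j then idx j else 1%N)) (sdt_e i T).

Definition inf_f n (i : Iq n) (T : filling) : option filling :=
  omap (restore_f n (if i is Some j then idx j else 1%N)) (sdt_f i T).

(* wt, eps and phi are those of T (x) t_{-lambda}, with lambda the shape of T *)
Definition SDT_inf n : crystal n :=
  @Crystal n filling
    [set T | (exists2 la : 'rV[int]_n, Lam la & is_SDT la T) /\
             dual_marginally_large n T]
    (fun T => wt (SDT_twist (sdt_shape n T)) (T, tt))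
    (fun i T => eps (SDT_twist (sdt_shape n T)) i (T, tt))
    (fun i T => phi (SDT_twist (sdt_shape n T)) i (T, tt))
    (@inf_e n) (@inf_f n).

(* Main.v *)
From mathcomp Require Import all_boot all_algebra.
From mathcomp Require Import boolp classical_sets functions.
From mathcomp Require Import zify.
Require Import Defs.

Set Implicit Arguments.
Unset Strict Implicit.
Unset Printing Implicit Defensive.
Import GRing.Theory.

(** Read row by row from the bottom, a tableau is a word, and e_i, f_i change the
    letter picked by the signature rule.  Two observations carry the proof.

    First, the maps of the directed system only lengthen initial runs.  In a
    semistandard decomposition tableau each letter [i] of the [i]-th row from
    the bottom is matched by the initial run of the row above
    ([SDT_low_matched]), so the added boxes contribute unmatched letters [i.+1]
    to the signature and nothing else ([rdbar_add]).  Hence operators commute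
    with the addition of boxes.  Two tableaux become equal in the direct limit
    if and only if the rows without their initial runs, the cores, agree
    ([dl_psiP]); the operators and the twisted weights and signatures therefore
    depend on the cores alone ([sdt_op_core_ex], [twist_core]).

    Second, if the initial runs are long, then semistandardness only says that
    the rows are hook words with bounded letters ([SDT_infP]), and a dual
    marginally large tableau is determined by its cores ([dml_filling_inj]),
    which can be prescribed ([inf_representative]).  So each class of the direct
    limit contains exactly one such tableau, which gives the bijection.  The
    box changed by an operator has no matching letter next to it, so rows stay
    hook words ([hook_active]), and it meets an initial run at most in its last
    box or just behind it ([active_pos]).  Restoring dual marginal largeness then
    yields the dual marginally large tableau in the class of the changed one
    ([inf_eP], [inf_fP]).  With this the crystal axioms, and the compatibility
    with the operators of the limit, follow from the corresponding facts for the
    signature rule: the changed box is characterized by a condition that does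
    not involve its own entry ([signature_box]), whence e and f are mutually
    inverse. *)

(** * Hook words *)

(** The turning point of a hook word is its first ascent, so being a hook word
    is a local condition: an ascent is followed by an ascent.  The effect of
    the change of one letter can be read off this form. *)
Lemma hook_wordP (u : seq nat) :
  reflect (u <> [::] /\ forall k, k.+2 < size u ->
             nth 0 u k < nth 0 u k.+1 -> nth 0 u k.+1 < nth 0 u k.+2)
          (hook_word u).
Proof.
apply: (iffP hasP) => [[k]|[u0 asc]].
  rewrite mem_iota => kb /andP[/(sortedP 0) dec /(sortedP 0) inc].
  split=> [u0|j jb ltj]; first by rewrite u0 /= in kb; lia.
  have kj : k <= j.+1.
    rewrite leqNgt; apply/negP => jk.
    have := dec j; rewrite size_takel; last by lia.
    by move=> /(_ jk); rewrite !nth_take //; lia.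
  have := inc (j.+1 - k.-1); rewrite size_drop !nth_drop.
  have -> : k.-1 + (j.+1 - k.-1) = j.+1 by lia.
  have -> : k.-1 + (j.+1 - k.-1).+1 = j.+2 by lia.
  by apply; lia.
(* the first ascent, or the last letter if there is none *)
have [a]: exists a, [&& a < size u,
    (size u <= a.+1) || (nth 0 u a < nth 0 u a.+1) &
    [forall j : 'I_a, (nth 0 u j.+1 <= nth 0 u j)]].
  pose P a := (size u <= a.+1) || (nth 0 u a < nth 0 u a.+1).
  have exP : exists a, P a by exists (size u); rewrite /P; lia.
  case: (ex_minnP exP) => a Pa amin; exists a; apply/and3P; split=> //.
    have : P (size u).-1 by rewrite /P; lia.
    by move/amin; case: (u) u0 => //= x s _; lia.
  apply/forallP => j; have := amin j; rewrite /P.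
  by case: j => j /= ja; lia.
case/and3P => au Pa /forallP dec.
exists a.+1; first by rewrite mem_iota; lia.
apply/andP; split; apply/(sortedP 0) => i; rewrite ?size_takel // ?size_drop.
  move=> ia; rewrite !nth_take //; last by lia.
  have ia' : i < a by lia.
  by have := dec (Ordinal ia').
rewrite /= !nth_drop => ib; elim: i ib => [|i IH] ib.
  by rewrite addn0 addn1; lia.
have := IH ltac:(lia).
have := asc (a + i); rewrite !addnS => H1 H2; apply: H1 => //; lia.
Qed.

Lemma hook_drop d (u : seq nat) :
  hook_word u -> d < size u -> hook_word (drop d u).
Proof.
move=> /hook_wordP[u0 asc] du; apply/hook_wordP; split.
  by move/(congr1 size); rewrite size_drop /=; lia.
move=> k; rewrite size_drop !nth_drop !addnS => kb; apply: asc; lia.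
Qed.

Lemma hook_cons x u : hook_word u -> head 0 u <= x -> hook_word (x :: u).
Proof.
move=> /hook_wordP[u0 asc] hx; apply/hook_wordP; split=> // -[|k] /= kb.
  by rewrite nth0; lia.
by apply: asc.
Qed.

Lemma hook_nseq_cat a x u :
  0 < a -> u = [::] \/ hook_word u /\ head 0 u <= x -> hook_word (nseq a x ++ u).
Proof.
case: a => // a _ hu; elim: a => [|a IH].
  by case: hu => [->|[hu hx]] //; apply: hook_cons.
by apply: (@hook_cons x) => //=.
Qed.

(** By [hook_wordP] only the comparisons of consecutive letters matter. *)
Lemma hook_set_nth u c x :
  hook_word u -> c < size u ->
  (0 < c -> (nth 0 u c.-1 < x) = (nth 0 u c.-1 < nth 0 u c)) ->
  (c.+1 < size u -> (x < nth 0 u c.+1) = (nth 0 u c < nth 0 u c.+1)) ->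
  hook_word (set_nth 0 u c x).
Proof.
move=> /hook_wordP[u0 asc] cu Hl Hr; apply/hook_wordP.
have szE : size (set_nth 0 u c x) = size u by rewrite size_set_nth; lia.
split; first by move/(congr1 size); rewrite szE; case: (u) u0.
have cmp j : j.+1 < size u -> (nth 0 (set_nth 0 u c x) j < nth 0 (set_nth 0 u c x) j.+1)
    = (nth 0 u j < nth 0 u j.+1).
  move=> ju; rewrite !nth_set_nth /=.
  case: (j =P c) => [jc|_]; first by rewrite jc in ju *; case: eqP => [|_]; [lia|exact: Hr].
  by case: eqP => [jc|//]; have := Hl; rewrite -jc; apply.
by rewrite szE => k kb; rewrite !cmp; [exact: asc|lia|lia].
Qed.

(** * The signature rule *)

Section Signature.
Variables (A : eqType) (l : A -> nat) (i : nat).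

Definition sig_step (b : A) (w : seq A) : seq A :=
  if w is b' :: w' then
    if (l b == i.+1) && (l b' == i) then w' else b :: w
  else [:: b].

(** [rdbar_i] for items of any type that carry letters [l]: the letters can then
    be changed, or the items transported, with the other data fixed. *)
Definition reduced (s : seq A) : seq A :=
  foldr sig_step [::] [seq b <- s | (l b == i) || (l b == i.+1)].

Definition is_low b := l b == i.
Definition is_high b := l b == i.+1.

Lemma is_high_low b : is_high b -> is_low b = false.
Proof. by rewrite /is_high /is_low => /eqP ->; lia. Qed.

Lemma is_low_high b : is_low b -> is_high b = false.
Proof. by rewrite /is_high /is_low => /eqP ->; lia. Qed.

Lemma reduced_cons x s :
  reduced (x :: s) = if is_low x || is_high x then sig_step x (reduced s) else reduced s.
Proof. by rewrite /reduced /=; case: ifP. Qed.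

Lemma reduced_mem s : {subset reduced s <= s}.
Proof.
elim: s => // x s IH y; rewrite reduced_cons inE.
case: ifP => _; last by move/IH ->; rewrite orbT.
rewrite /sig_step; case E: (reduced s) IH => [|b w] IH.
  by rewrite inE => ->.
case: ifP => _; first by move=> yw; rewrite IH ?orbT // inE yw orbT.
by rewrite inE => /orP[->//|/IH ->]; rewrite orbT.
Qed.

Lemma reduced_letters s : all [pred b | is_low b || is_high b] (reduced s).
Proof.
elim: s => // x s IH; rewrite reduced_cons; case: ifP => // xIS.
rewrite /sig_step; case: (reduced s) IH => [|b w] /=; first by rewrite xIS.
by case: ifP => _ /andP[h1 h2] //=; rewrite xIS h1.
Qed.

(** A pair that is cancelled across the two factors needs an unmatched [i.+1]
    in the left one, or, in [reduced_cat_high], an unmatched [i] in the right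
    one. *)
Lemma reduced_cat_low s1 s2 :
  all is_low (reduced s1) -> reduced (s1 ++ s2) = reduced s1 ++ reduced s2.
Proof.
elim: s1 => // x s IH; rewrite cat_cons !reduced_cons.
case: ifP => // xIS; rewrite {1 3}/sig_step.
case E: (reduced s) IH => [|b w] IH.
  rewrite /= andbT => xI; rewrite IH //= /sig_step.
  case: (reduced s2) => // c w; case: ifP => // /andP[xS _].
  by rewrite is_high_low in xI.
case: ifP => [/andP[xS bI] aw|_ /= /andP[xI abw]].
  rewrite (_ : reduced (s ++ s2) = (b :: w) ++ reduced s2); last first.
    by apply: IH; rewrite /= aw /is_low bI.
  by rewrite /= xS bI.
rewrite IH //= /sig_step; case: ifP => // /andP[xS _].
by rewrite is_high_low in xI.
Qed.

Lemma reduced_cat_high s1 s2 :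
  all is_high (reduced s2) -> reduced (s1 ++ s2) = reduced s1 ++ reduced s2.
Proof.
move=> h; elim: s1 => // x s IH; rewrite cat_cons !reduced_cons IH.
case: ifP => // xIS; rewrite {1 2}/sig_step.
case: (reduced s) => [|b w] /=; last by case: ifP.
case: (reduced s2) h => //= b w /andP[bS _].
by case: ifP => // /andP[_ bI]; rewrite /is_high (eqP bI) in bS; lia.
Qed.

(** A letter [b] at the border between the surviving letters [i] and [i.+1] is
    never reached by a cancellation, so both sides of it are reduced
    independently.  With the converse [reduced_join] this turns the algorithm
    into a condition that treats [i] and [i.+1] alike. *)
Lemma reduced_split s A1 b B :
  reduced s = A1 ++ b :: B -> all is_low A1 -> all is_high B ->
  exists s1 s2, [/\ s = s1 ++ b :: s2, reduced s1 = A1 & reduced s2 = B].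
Proof.
elim: s A1 => [[]//|x s IH] A1; rewrite reduced_cons.
have recur s1 s2 A2 : s = s1 ++ b :: s2 -> reduced s1 = A2 -> reduced s2 = B ->
    (if is_low x || is_high x then sig_step x A2 else A2) = A1 ->
    exists s1 s2, [/\ x :: s = s1 ++ b :: s2, reduced s1 = A1 & reduced s2 = B].
  by move=> -> r1 r2 h; exists (x :: s1), s2; rewrite reduced_cons r1 h.
case: ifP recur => [xIS|_] recur; last first.
  by move=> h aI aS; have [s1 [s2 [e1 e2 e3]]] := IH _ h aI aS; apply: (recur s1 s2 A1).
have push : reduced s = behead (A1 ++ b :: B) -> x = head x (A1 ++ b :: B) ->
    all is_low A1 -> all is_high B ->
    exists s1 s2, [/\ x :: s = s1 ++ b :: s2, reduced s1 = A1 & reduced s2 = B].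
  case: A1 recur => [|a A1] recur /= h xE.
    by move=> _ _; exists [::], s; rewrite h xE.
  case/andP => aI aI1 aS; have [s1 [s2 [e1 e2 e3]]] := IH _ h aI1 aS.
  apply: (recur s1 s2 A1) => //; rewrite -xE in aI *; rewrite /sig_step.
  case: (A1) => // c w; case: ifP => // /andP[xS _].
  by rewrite is_high_low in aI.
rewrite /sig_step; case E: (reduced s) push => [|c w] push.
  by move=> h; apply: push; rewrite -h.
case: ifP => [/andP[xS cI] h aI aS|_ h]; last by apply: push; rewrite -h.
have [||//|s1 [s2 [e1 e2 e3]]] := IH (c :: A1); rewrite ?E ?h //=.
  by rewrite aI /is_low cI.
by apply: (recur s1 s2 (c :: A1)) => //; rewrite /sig_step xS cI.
Qed.

Lemma reduced_join s1 b s2 :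
  all is_low (reduced s1) -> all is_high (reduced s2) -> is_low b || is_high b ->
  reduced (s1 ++ b :: s2) = reduced s1 ++ b :: reduced s2.
Proof.
move=> h1 h2 hb; rewrite reduced_cat_low // reduced_cons hb /sig_step.
case: (reduced s2) h2 => //= c w /andP[cS _].
by case: ifP => // /andP[_ cI]; rewrite /is_high (eqP cI) in cS; lia.
Qed.

(** An [i.+1] that precedes an [i] would be cancelled with it, or with a letter
    between them. *)
Lemma reduced_form s :
  reduced s = [seq b <- reduced s | is_low b] ++ [seq b <- reduced s | is_high b].
Proof.
elim: s => // x s IH; rewrite reduced_cons; case: ifP => // xIS.
rewrite /sig_step; case E: (reduced s) IH => [|c w] IH.
  by rewrite /=; case: ifP xIS => [/is_low_high ->|_ /= ->].
have cIS : is_low c || is_high c by have := reduced_letters s; rewrite E => /andP[].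
case: ifP => [/andP[xS cI]|nS].
  by move: IH; rewrite /= {1 3}/is_low cI is_low_high ?/is_low ?cI //= => -[].
case xI: (is_low x).
  by rewrite /= xI is_low_high // cat_cons -IH.
have cI : is_low c = false by move: nS xIS; rewrite xI /= /is_high => + xS; rewrite xS.
rewrite xI /= in xIS.
move: IH; rewrite /= xI xIS cI.
rewrite cI /= in cIS; rewrite cIS.
case F: [seq b <- w | is_low b] => [|y v] /=; first by move=> {1}->.
case => yc _; have : y \in [seq b <- w | is_low b] by rewrite F mem_head.
by rewrite mem_filter -yc cI.
Qed.

Lemma reduced_all_high s : all is_high s -> reduced s = s.
Proof.
elim: s => // x s IH /= /andP[xS sS]; rewrite reduced_cons xS orbT IH // /sig_step.
case: s sS {IH} => //= c w /andP[cS _].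
by case: ifP => // /andP[_ cI]; rewrite /is_high (eqP cI) in cS; lia.
Qed.

Lemma reduced_all_low s : all is_low s -> reduced s = s.
Proof.
elim: s => // x s IH /= /andP[xI sI]; rewrite reduced_cons xI IH // /sig_step.
case: s sI {IH} => //= c w _; case: ifP => // /andP[xS _].
by rewrite is_high_low in xI.
Qed.

(** Each letter of [E] cancels the last letter of [D] that remains. *)
Lemma reduced_high_low D E : all is_high D -> all is_low E -> size E <= size D ->
  reduced (D ++ E) = take (size D - size E) D.
Proof.
elim/last_ind: D E => [|D x IH] [|e E] //=.
- by rewrite cats0 => h _ _; rewrite subn0 take_size reduced_all_high.
rewrite all_rcons size_rcons => /andP[xS DS] /andP[eI EI] szE.
have h : reduced (x :: e :: E) = reduced E.
  rewrite reduced_cons xS orbT !reduced_all_low //= ?eI // /sig_step.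
  by move: xS eI; rewrite /is_low /is_high => -> ->.
have -> : reduced (rcons D x ++ e :: E) = reduced (D ++ E).
  rewrite cat_rcons /reduced filter_cat [in RHS]filter_cat !foldr_cat.
  by congr foldr; exact: h.
rewrite IH // subSS -cats1 takel_cat //; lia.
Qed.

End Signature.

Lemma eq_reduced (A : eqType) (l1 l2 : A -> nat) i s :
  {in s, l1 =1 l2} -> reduced l1 i s = reduced l2 i s.
Proof.
elim: s => // x s IH h; rewrite !reduced_cons IH; last first.
  by move=> y ys; apply: h; rewrite inE ys orbT.
rewrite /is_low /is_high (h x) ?mem_head // /sig_step.
case E: (reduced l2 i s) => [|b w] //.
by rewrite (h x) ?mem_head // (h b) // inE (@reduced_mem _ l2 i s) ?orbT // E mem_head.
Qed.

Lemma reduced_map (A B : eqType) (h : A -> B) (l : B -> nat) i s :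
  reduced l i (map h s) = map h (reduced (l \o h) i s).
Proof.
elim: s => // x s IH; rewrite map_cons !reduced_cons IH /is_low /is_high /=.
case: ifP => // _; rewrite /sig_step; case: (reduced _ _ s) => //= b w.
by case: ifP.
Qed.

(** * Boxes and the change of one entry *)

Lemma mem_rd_boxes T b :
  (b \in rd_boxes T) = (b.1 < size T) && (b.2 < size (nth [::] T b.1)).
Proof.
apply/allpairsPdep/andP => [[r [c [hr hc ->]]]|[h1 h2]].
  by move: hr hc; rewrite mem_rev !mem_iota /=; lia.
by exists b.1, b.2; split; [rewrite mem_iota|rewrite mem_rev mem_iota|case: (b)].
Qed.

Lemma uniq_rd_boxes T : uniq (rd_boxes T).
Proof.
apply: (@allpairs_uniq_dep nat (fun=> nat) _ (fun r c => (r, c))).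
- exact: iota_uniq.
- by move=> r _; rewrite rev_uniq iota_uniq.
- by move=> [r c] [r' c'] _ _ /= [-> ->].
Qed.

Lemma nth_set_entry T b x r :
  nth [::] (set_entry T b x) r =
  if r == b.1 then set_nth 0 (nth [::] T b.1) b.2 x else nth [::] T r.
Proof. by rewrite nth_set_nth. Qed.

Lemma entry_set T b x b' :
  entry (set_entry T b x) b' = if b' == b then x else entry T b'.
Proof.
rewrite /entry nth_set_entry; case: b b' => [r c] [r' c'] /=.
by rewrite xpair_eqE; case: eqP => [->|] //=; rewrite nth_set_nth.
Qed.

Lemma size_set_entry T b x : b \in rd_boxes T -> size (set_entry T b x) = size T.
Proof. by rewrite mem_rd_boxes size_set_nth => /andP[h _]; apply/maxn_idPr. Qed.

Lemma size_nth_set_entry T b x r : b \in rd_boxes T ->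
  size (nth [::] (set_entry T b x) r) = size (nth [::] T r).
Proof.
rewrite mem_rd_boxes nth_set_entry => /andP[_ h].
by case: eqP => [->|//]; rewrite size_set_nth; apply/maxn_idPr.
Qed.

Lemma rd_boxes_shape T U : size T = size U ->
  (forall r, size (nth [::] T r) = size (nth [::] U r)) -> rd_boxes T = rd_boxes U.
Proof. by move=> h1 h2; rewrite /rd_boxes h1; congr flatten; apply: eq_map => r; rewrite h2. Qed.

Lemma rd_boxes_set T b x : b \in rd_boxes T -> rd_boxes (set_entry T b x) = rd_boxes T.
Proof.
by move=> bT; apply: rd_boxes_shape => [|r]; rewrite ?size_set_entry ?size_nth_set_entry.
Qed.

Lemma filling_ext (T U : filling) : size T = size U ->
  (forall r, size (nth [::] T r) = size (nth [::] U r)) ->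
  entry T =1 entry U -> T = U.
Proof.
move=> h1 h2 h3; apply: (@eq_from_nth _ [::]) => // r _.
by apply: (@eq_from_nth _ 0) => // c _; exact: (h3 (r, c)).
Qed.

Lemma set_entryK T b x : b \in rd_boxes T ->
  set_entry (set_entry T b x) b (entry T b) = T.
Proof.
move=> bT; apply: filling_ext => [|r|b'].
- by rewrite !size_set_entry ?rd_boxes_set.
- by rewrite !size_nth_set_entry ?rd_boxes_set.
- by rewrite !entry_set; case: eqP => [->|].
Qed.

Lemma set_entryC T b c x y : b \in rd_boxes T -> c \in rd_boxes T -> b != c ->
  set_entry (set_entry T b x) c y = set_entry (set_entry T c y) b x.
Proof.
move=> bT cT bc; apply: filling_ext => [|r|b'].
- by rewrite !size_set_entry ?rd_boxes_set.
- by rewrite !size_nth_set_entry ?rd_boxes_set.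
- by rewrite !entry_set; case: eqP => [->|] //; rewrite eq_sym (negPf bc).
Qed.

Lemma uniq_cat_inj (A : eqType) (b : A) s1 s2 t1 t2 :
  uniq (s1 ++ b :: s2) -> s1 ++ b :: s2 = t1 ++ b :: t2 -> s1 = t1 /\ s2 = t2.
Proof.
move=> us E; have ut : uniq (t1 ++ b :: t2) by rewrite -E.
have szE s t : uniq (s ++ b :: t) -> index b (s ++ b :: t) = size s.
  rewrite cat_uniq index_cat => /and3P[_ /hasPn h _].
  by rewrite (negPf (h b (mem_head _ _))) /= eqxx addn0.
have sz : size s1 = size t1 by rewrite -(szE _ _ us) -(szE _ _ ut) E.
by have /eqP := E; rewrite eqseq_cat // eqseq_cons => /and3P[/eqP-> _ /eqP->].
Qed.

Lemma rd_boxes_adj T r c : r < size T -> c.+1 < size (nth [::] T r) ->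
  exists P Q, rd_boxes T = P ++ (r, c.+1) :: (r, c) :: Q.
Proof.
move=> rT cT.
have [P [Q E]] : exists P Q,
    [seq (r, k) | k <- rev (iota 0 (size (nth [::] T r)))] = P ++ (r, c.+1) :: (r, c) :: Q.
  have -> : size (nth [::] T r) = c + (2 + (size (nth [::] T r) - c.+2)) by lia.
  rewrite iotaD (iotaD _ 2) !rev_cat !map_cat /=.
  exists [seq (r, k) | k <- rev (iota (c + 2) (size (nth [::] T r) - c.+2))].
  exists [seq (r, k) | k <- rev (iota 0 c)].
  by rewrite -catA /= /rev /= add0n.
rewrite /rd_boxes (_ : size T = r + (1 + (size T - r.+1))); last by lia.
rewrite iotaD (iotaD _ 1) !map_cat !flatten_cat /= cats0 add0n E.
by rewrite -catA /= catA; eexists; eexists; reflexivity.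
Qed.

(** * The box changed by an operator *)

(** The box that e_i or f_i changes: to the left of it in rd_i no [i.+1], and to
    the right of it no [i], is left unmatched.  The entry of [b] itself is not
    mentioned, so the condition persists when that entry is toggled; this makes
    e_i and f_i inverse to each other. *)
Definition signature_box (i : nat) (T : filling) (b : box) : Prop :=
  exists s1 s2, [/\ rd_boxes T = s1 ++ b :: s2,
    all (is_low (entry T) i) (reduced (entry T) i s1) &
    all (is_high (entry T) i) (reduced (entry T) i s2)].

(** For \bar 1 the box is the leftmost one of rd_1, which again does not depend on
    whether its entry is 1 or 2. *)
Definition active n (i : Iq n) (T : filling) (b : box) : Prop :=
  if i is Some j then signature_box j T b else ohead (rd_i 1 T) = Some b.

(** The operators indexed by [i] exchange the letters [low i] and
    [(low i).+1]. *)
Definition low n (i : Iq n) : nat := if i is Some j then idx j else 1.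

Lemma rdbar_reduced i T : rdbar_i i T = reduced (entry T) i (rd_boxes T).
Proof. by []. Qed.

Lemma change_eP i T T' : change_e i T = Some T' <->
  exists b, [/\ signature_box i T b, entry T b = i.+1 & T' = set_entry T b i].
Proof.
rewrite /change_e rdbar_reduced; set r := reduced _ _ _; split.
  have rE : r = [seq b <- r | is_low (entry T) i b] ++ [seq b <- r | is_high (entry T) i b].
    exact: reduced_form.
  rewrite -[X in ohead X]/[seq b <- r | is_high (entry T) i b].
  case E: [seq b <- r | is_high (entry T) i b] => [|b B] //= [<-].
  rewrite E in rE; have [||s1 [s2 [e1 e2 e3]]] := reduced_split rE.
  - exact: filter_all.
  - by have := filter_all (is_high (entry T) i) r; rewrite E => /andP[].
  have : b \in [seq b <- r | is_high (entry T) i b] by rewrite E mem_head.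
  rewrite mem_filter => /andP[/eqP bi _].
  exists b; split=> //; exists s1, s2; rewrite e1 e2 e3; split=> //.
    exact: filter_all.
  by have := filter_all (is_high (entry T) i) r; rewrite E => /andP[].
case=> b [[s1 [s2 [e1 e2 e3]]] bi ->].
have -> : r = reduced (entry T) i s1 ++ b :: reduced (entry T) i s2.
  by rewrite /r e1 reduced_join // /is_high bi eqxx orbT.
rewrite filter_cat (_ : [seq _ <- reduced _ _ s1 | _] = [::]).
  by rewrite /= bi eqxx.
apply/eqP; rewrite -[_ == _]negbK -has_filter; apply/hasPn => c cs.
by have := allP e2 _ cs => /is_low_high; rewrite /is_high => ->.
Qed.

Lemma change_fP i T T' : change_f i T = Some T' <->
  exists b, [/\ signature_box i T b, entry T b = i & T' = set_entry T b i.+1].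
Proof.
rewrite /change_f rdbar_reduced; set r := reduced _ _ _; split.
  have rE : r = [seq b <- r | is_low (entry T) i b] ++ [seq b <- r | is_high (entry T) i b].
    exact: reduced_form.
  rewrite -[X in ohead (rev X)]/[seq b <- r | is_low (entry T) i b].
  case/lastP E: [seq b <- r | is_low (entry T) i b] => [|A b] //.
  rewrite rev_rcons /= => -[<-].
  rewrite E cat_rcons in rE; have [||s1 [s2 [e1 e2 e3]]] := reduced_split rE.
  - by have := filter_all (is_low (entry T) i) r; rewrite E all_rcons => /andP[].
  - exact: filter_all.
  have : b \in [seq b <- r | is_low (entry T) i b] by rewrite E mem_rcons mem_head.
  rewrite mem_filter => /andP[/eqP bi _].
  exists b; split=> //; exists s1, s2; rewrite e1 e2 e3; split=> //.
    by have := filter_all (is_low (entry T) i) r; rewrite E all_rcons => /andP[].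
  exact: filter_all.
case=> b [[s1 [s2 [e1 e2 e3]]] bi ->].
have -> : r = reduced (entry T) i s1 ++ b :: reduced (entry T) i s2.
  by rewrite /r e1 reduced_join // /is_low bi eqxx.
rewrite filter_cat /= bi eqxx (_ : [seq _ <- reduced _ _ s2 | _] = [::]).
  by rewrite rev_cat.
apply/eqP; rewrite -[_ == _]negbK -has_filter; apply/hasPn => c cs.
by have := allP e3 _ cs => /is_high_low; rewrite /is_low => ->.
Qed.

Lemma sdt_eP n (i : Iq n) T T' : sdt_e i T = Some T' <->
  exists b, [/\ active i T b, entry T b = (low i).+1 & T' = set_entry T b (low i)].
Proof.
case: i => [j|] /=; first exact: change_eP.
rewrite /change_e1bar; case: (rd_i 1 T) => [|b s] /=.
  by split=> // -[b []].
case: eqP => bE; split=> //.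
- by case=> <-; exists b.
- by case=> _ [[<-] _ ->].
- by case=> _ [[<-] /bE].
Qed.

Lemma sdt_fP n (i : Iq n) T T' : sdt_f i T = Some T' <->
  exists b, [/\ active i T b, entry T b = low i & T' = set_entry T b (low i).+1].
Proof.
case: i => [j|] /=; first exact: change_fP.
rewrite /change_f1bar; case: (rd_i 1 T) => [|b s] /=.
  by split=> // -[b []].
case: eqP => bE; split=> //.
- by case=> <-; exists b.
- by case=> _ [[<-] _ ->].
- by case=> _ [[<-] /bE].
Qed.

Lemma active_mem n (i : Iq n) T b : active i T b -> b \in rd_boxes T.
Proof.
case: i => [j|] /=; first by case=> s1 [s2 [-> _ _]]; rewrite mem_cat mem_head orbT.
case E: (rd_i 1 T) => [|c s] //= cb.
have : c \in rd_i 1 T by rewrite E mem_head.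
by case: cb => ->; rewrite mem_filter => /andP[].
Qed.

Definition letter (i a : nat) : bool := (a == i) || (a == i.+1).

Lemma active_set n (i : Iq n) T b x : active i T b ->
  letter (low i) (entry T b) -> letter (low i) x -> active i (set_entry T b x) b.
Proof.
move=> act bE xE; have bT := active_mem act.
case: i act bE xE => [j|] /=; last first.
  move=> bh bE xE; rewrite -[RHS]bh; congr ohead; rewrite /rd_i rd_boxes_set //.
  apply: eq_in_filter => c _; rewrite entry_set.
  by case: (c =P b) => [->|//]; rewrite /letter in bE xE; rewrite bE xE.
case=> s1 [s2 [E h1 h2]] _ _; exists s1, s2; split; first by rewrite rd_boxes_set.
  have := uniq_rd_boxes T; rewrite E cat_uniq => /and3P[_ /hasPn h _].
  have eqE : {in s1, entry (set_entry T b x) =1 entry T}.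
    move=> c cs; rewrite entry_set; case: eqP => // cb.
    by have := h b (mem_head _ _); rewrite -cb /= cs.
  rewrite (eq_reduced _ eqE); apply/allP => c cs; rewrite /is_low eqE.
    exact: (allP h1).
  exact: reduced_mem cs.
have := uniq_rd_boxes T; rewrite E cat_uniq => /and3P[_ _ /andP[/negP h _]].
have eqE : {in s2, entry (set_entry T b x) =1 entry T}.
  by move=> c cs; rewrite entry_set; case: eqP => // cb; rewrite cb in cs.
rewrite (eq_reduced _ eqE); apply/allP => c cs; rewrite /is_high eqE.
  exact: (allP h2).
exact: reduced_mem cs.
Qed.

Lemma active_toggle n (i : Iq n) T b x y :
  active i T b -> entry T b = x -> letter (low i) x -> letter (low i) y ->
  [/\ active i (set_entry T b y) b, entry (set_entry T b y) b = y &
      T = set_entry (set_entry T b y) b x].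
Proof.
move=> act bE xE yE; split; first by apply: active_set; rewrite ?bE.
    by rewrite entry_set eqxx.
  by rewrite -bE set_entryK // (active_mem act).
Qed.

Lemma sdt_feP n (i : Iq n) T T' : sdt_f i T = Some T' <-> sdt_e i T' = Some T.
Proof.
have l1 : letter (low i) (low i) by rewrite /letter eqxx.
have l2 : letter (low i) (low i).+1 by rewrite /letter eqxx orbT.
rewrite sdt_fP sdt_eP; split=> -[b [act bE ->]]; exists b; exact: active_toggle.
Qed.

(** * Hook words are preserved *)

(** Otherwise that letter would end the part of rd on the left of the box, and
    nothing there could cancel it. *)
Lemma signature_box_next i T r c : signature_box i T (r, c) -> c.+1 < size (nth [::] T r) ->
  entry T (r, c.+1) != i.+1.
Proof.
move=> [s1 [s2 [E h1 _]]] cT.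
have : (r, c) \in rd_boxes T by rewrite E mem_cat mem_head orbT.
rewrite mem_rd_boxes /= => /andP[rT _].
have [P [Q E']] := rd_boxes_adj rT cT.
have [e1 _] : s1 = rcons P (r, c.+1) /\ s2 = Q.
  by apply: (@uniq_cat_inj _ (r, c)); rewrite -?E ?uniq_rd_boxes // E' cat_rcons.
apply/negP => nE; have nS : all (is_high (entry T) i) [:: (r, c.+1)] by rewrite /= /is_high nE.
move: h1; rewrite e1 -cats1 reduced_cat_high (reduced_all_high nS) // all_cat /= /is_low (eqP nE).
by lia.
Qed.

(** Otherwise that letter would begin the part of rd on the right of the box,
    and nothing there could cancel it. *)
Lemma signature_box_prev i T r c : signature_box i T (r, c.+1) -> entry T (r, c) != i.
Proof.
move=> [s1 [s2 [E _ h2]]].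
have : (r, c.+1) \in rd_boxes T by rewrite E mem_cat mem_head orbT.
rewrite mem_rd_boxes /= => /andP[rT cT].
have [P [Q E']] := rd_boxes_adj rT cT.
have [_ e2] : s1 = P /\ s2 = (r, c) :: Q.
  by apply: (@uniq_cat_inj _ (r, c.+1)); rewrite -?E ?uniq_rd_boxes // E'.
apply/negP => nE; have nI : all (is_low (entry T) i) [:: (r, c)] by rewrite /= /is_low nE.
move: h2; rewrite e2 -cat1s reduced_cat_low (reduced_all_low nI) // all_cat /= /is_high (eqP nE).
by lia.
Qed.

Lemma active1_next n (i : Iq n) T r c : i = None -> active i T (r, c) ->
  c.+1 < size (nth [::] T r) -> letter 1 (entry T (r, c.+1)) = false.
Proof.
move=> -> /= hd cT.
have : (r, c) \in rd_boxes T by apply: (@active_mem n None).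
rewrite mem_rd_boxes /= => /andP[rT _].
have [P [Q E]] := rd_boxes_adj rT cT.
apply/negP => nE; have := uniq_rd_boxes T; rewrite E cat_uniq.
case/and3P => _ /hasPn h /= /andP[h' _]; move: hd h.
rewrite /rd_i E filter_cat /= -/(letter 1 _) nE.
case F: (filter _ P) => [|b s] /= [bE]; first by rewrite bE mem_head in h'.
move/(_ (r, c)); rewrite !inE eqxx orbT /= => /(_ isT) /negP; apply.
suff : b \in [seq b <- P | letter 1 (entry T b)] by rewrite bE mem_filter => /andP[].
by rewrite F mem_head.
Qed.

(** The comparison with the previous letter changes only if that letter is 1; no
    ascent ends in a 1, and all letters behind [c] ascend in either case. *)
Lemma hook_set_12 u c x : hook_word u -> all (leq 1) u -> c < size u ->
  letter 1 (nth 0 u c) -> letter 1 x ->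
  (c.+1 < size u -> letter 1 (nth 0 u c.+1) = false) ->
  hook_word (set_nth 0 u c x).
Proof.
move=> /hook_wordP[u0 asc] /(all_nthP 0) pos cu lc lx nx; apply/hook_wordP.
have szE : size (set_nth 0 u c x) = size u by rewrite size_set_nth; apply/maxn_idPr.
split; first by move/(congr1 size); rewrite szE; case: (u) u0.
move=> k; rewrite szE !nth_set_nth /= /letter in lc lx nx * => kb.
have := asc k kb; have := pos k; have := pos k.+1; have := pos k.+2.
case: (k =P c) => [?|kc]; last case: (k.+1 =P c) => [?|kc']; last case: (k.+2 =P c) => [?|kc''].
- by subst k; do ?case: eqP => ?; lia.
- by subst c; do ?case: eqP => ?; lia.
- by subst c; lia.
- by lia.
Qed.

(** For i in I_0 no comparison with a neighbour changes: this would need an [i]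
    on the left of the box or an [i.+1] on its right. *)
Lemma hook_active n (i : Iq n) T r c x : active i T (r, c) ->
  letter (low i) (entry T (r, c)) -> letter (low i) x ->
  hook_word (nth [::] T r) -> all (leq 1) (nth [::] T r) ->
  hook_word (set_nth 0 (nth [::] T r) c x).
Proof.
move=> act lc lx hk pos; have := active_mem act.
rewrite mem_rd_boxes /= => /andP[_ cT].
case: i act lc lx => [j|] act lc lx; last first.
  by apply: hook_set_12 => //; apply: active1_next act.
apply: hook_set_nth => //.
  case: c act lc {cT} => // c act lc _ /=; have := signature_box_prev act.
  by move: lc lx; rewrite /letter /low /entry /=; lia.
move=> /(signature_box_next act); move: lc lx; rewrite /letter /low /entry /=; lia.
Qed.

(** * Initial runs, rows counted from the bottom, and cores *)

Lemma run_le i u : run i u <= size u.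
Proof. exact: find_size. Qed.

Lemma run_nseq_cat i a u : run i (nseq a i ++ u) = a + run i u.
Proof. by elim: a => //= a IH; rewrite /run /= eqxx /= -/(run _ _) IH addSn. Qed.

Lemma nth_run i u c : c < run i u -> nth 0 u c = i.
Proof. by move=> h; have := before_find 0 h => /negbFE/eqP. Qed.

Lemma nth_run_stop i u : run i u < size u -> nth 0 u (run i u) != i.
Proof. by rewrite -has_find => /(nth_find 0). Qed.

Lemma run_cat_drop i u : u = nseq (run i u) i ++ drop (run i u) u.
Proof.
rewrite -[LHS](cat_take_drop (run i u)); congr (_ ++ _).
apply: (@eq_from_nth _ 0) => [|c]; rewrite size_takel ?run_le ?size_nseq //.
by move=> cu; rewrite nth_take // nth_nseq cu (nth_run cu).
Qed.

Lemma run_drop i u : run i (drop (run i u) u) = 0.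
Proof.
by have /(congr1 (run i)) := run_cat_drop i u; rewrite run_nseq_cat; lia.
Qed.

Lemma run_eq i u d : d <= size u -> (forall c, c < d -> nth 0 u c = i) ->
  (d < size u -> nth 0 u d != i) -> run i u = d.
Proof.
move=> du h1 h2; case: (ltngtP (run i u) d) => // [rd|dr].
  by have := nth_run_stop (leq_trans rd du); rewrite h1 // eqxx.
by have := h2 (leq_trans dr (run_le _ _)); rewrite (nth_run dr) eqxx.
Qed.

(** Rows are numbered from the bottom: in a dual marginally large tableau the
    row [j] is the one that begins with letters [j]. *)
Definition brow n (T : filling) (j : nat) : seq nat := nth [::] T (n - j).

(** What is left of a row without its initial run.  The maps of the directed
    system only lengthen the initial runs, and the cores turn out to be a
    complete invariant of the elements of the direct limit. *)
Definition core n (T : filling) (j : nat) : seq nat :=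
  drop (run j (brow n T j)) (brow n T j).

Definition same_core n (T U : filling) : Prop :=
  forall j, 0 < j <= n -> core n T j = core n U j.

Definition bounded n (T : filling) : Prop :=
  size T = n /\ forall j, 0 < j <= n -> all (fun a => 0 < a <= j) (brow n T j).

Lemma size_add_left n m T : size (add_left n m T) = n.
Proof. by rewrite size_map size_iota. Qed.

Lemma nth_add_left n m T r : r < n ->
  nth [::] (add_left n m T) r = nseq (m r.+1) (n - r) ++ nth [::] T r.
Proof. by move=> rn; rewrite (nth_map 0) ?size_iota // nth_iota // add1n subSS. Qed.

Lemma brow_add_left n m T j : 0 < j <= n ->
  brow n (add_left n m T) j = nseq (m (n - j).+1) j ++ brow n T j.
Proof.
by move=> jn; rewrite /brow nth_add_left; [congr (nseq _ _ ++ _); lia|lia].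
Qed.

Lemma brow_remove_left n m T j : 0 < j <= n ->
  brow n (remove_left n m T) j = drop (m (n - j).+1) (brow n T j).
Proof.
move=> jn; rewrite /brow (nth_map 0) ?size_iota //; last lia.
by rewrite nth_iota //; lia.
Qed.

Lemma brow_ext n T U : size T = n -> size U = n ->
  (forall j, 0 < j <= n -> brow n T j = brow n U j) -> T = U.
Proof.
move=> sT sU h; apply: (@eq_from_nth _ [::]) => [|r rT]; first by rewrite sT.
by have := h (n - r) ltac:(lia); rewrite /brow (_ : n - (n - r) = r) //; lia.
Qed.

Lemma core_add_left n m T j : 0 < j <= n -> core n (add_left n m T) j = core n T j.
Proof.
move=> jn; rewrite /core brow_add_left // run_nseq_cat drop_cat size_nseq.
by case: ltnP => h; [lia|rewrite addKn].
Qed.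

Lemma size_nth_flatten (T : filling) r : size (nth [::] T r) <= size (flatten T).
Proof.
elim: T r => [|u T IH] [|r] //=; rewrite size_cat ?leq_addr //.
by apply: leq_trans (IH r) (leq_addl _ _).
Qed.

(** Initial runs of length [j * N] in the row [j] serve both tableaux if [N] is
    large, and make the numbers of added boxes increase towards the top. *)
Lemma same_core_ext n T U : same_core n T U ->
  exists m m', [/\ add_left n m T = add_left n m' U,
    forall j, 0 < j < n -> m (n - j).+1 <= m (n - j) &
    forall j, 0 < j < n -> m' (n - j).+1 <= m' (n - j)].
Proof.
move=> h; pose N := size (flatten T) + size (flatten U).
pose ext V k := (n.+1 - k) * N - run (n.+1 - k) (brow n V (n.+1 - k)).
have runN V j : V \in [:: T; U] -> run j (brow n V j) <= N.
  rewrite !inE => hV; apply: leq_trans (run_le _ _) _.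
  have := size_nth_flatten T (n - j); have := size_nth_flatten U (n - j).
  by rewrite /N /brow; case/orP: hV => /eqP ->; lia.
have mono V : V \in [:: T; U] -> forall j, 0 < j < n -> ext V (n - j).+1 <= ext V (n - j).
  move=> hV j jn; rewrite /ext.
  rewrite (_ : n.+1 - (n - j).+1 = j); last lia.
  rewrite (_ : n.+1 - (n - j) = j.+1); last lia.
  by have := runN V j.+1 hV; nia.
exists (ext T), (ext U); split; try by apply: mono; rewrite !inE eqxx ?orbT.
apply: (@brow_ext n); rewrite ?size_add_left // => j jn.
rewrite !brow_add_left // [brow n T j](run_cat_drop j) [brow n U j](run_cat_drop j).
rewrite -/(core n T j) -/(core n U j) h // !catA -!nseqD; congr (nseq _ _ ++ _).
rewrite /ext (_ : n.+1 - (n - j).+1 = j); last lia.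
have := runN T j; have := runN U j; rewrite !inE !eqxx orbT => /(_ isT) ? /(_ isT) ?.
by nia.
Qed.

Lemma same_core_sym n T U : same_core n T U -> same_core n U T.
Proof. by move=> h j jn; rewrite h. Qed.

Lemma same_core_trans n T U V : same_core n T U -> same_core n U V -> same_core n T V.
Proof. by move=> h1 h2 j jn; rewrite h1 // h2. Qed.

Lemma same_core_add n m m' T U : add_left n m T = add_left n m' U -> same_core n T U.
Proof. by move=> E j jn; rewrite -(core_add_left m) // E core_add_left. Qed.

(** * Adding boxes on the left *)

Definition shift (m : nat -> nat) (b : box) : box := (b.1, b.2 + m b.1.+1).

Lemma entry_shift n m T b : b.1 < n -> entry (add_left n m T) (shift m b) = entry T b.
Proof.
move=> bn; rewrite /entry /shift /= nth_add_left // nth_cat size_nseq.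
by rewrite ltnNge leq_addl addnK.
Qed.

Lemma set_nth_nseq_cat a j u c x :
  set_nth 0 (nseq a j ++ u) (c + a) x = nseq a j ++ set_nth 0 u c x.
Proof. by elim: a => [|a IH]; rewrite ?addn0 // addnS /= IH. Qed.

Lemma add_left_set n m T b x : size T = n -> b \in rd_boxes T ->
  add_left n m (set_entry T b x) = set_entry (add_left n m T) (shift m b) x.
Proof.
rewrite mem_rd_boxes => sT /andP[bT _].
apply: (@eq_from_nth _ [::]) => [|r].
  by rewrite size_add_left size_set_nth size_add_left /=; symmetry; apply/maxn_idPr; rewrite -sT.
rewrite size_add_left => rn; rewrite nth_add_left // !nth_set_entry /=.
case: eqP => [->|_]; last by rewrite nth_add_left.
by rewrite nth_add_left -?set_nth_nseq_cat // -sT.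
Qed.

(** Segments of rows are listed in the order of rd, from right to left. *)
Definition seg (r a k : nat) : seq box := [seq (r, c) | c <- rev (iota a k)].

Lemma segD r a k1 k2 : seg r a (k1 + k2) = seg r (a + k1) k2 ++ seg r a k1.
Proof. by rewrite /seg iotaD rev_cat map_cat. Qed.

Lemma map_shift_seg m r a k : map (shift m) (seg r a k) = seg r (a + m r.+1) k.
Proof.
rewrite /seg -map_comp -[a + _]addnC iotaDl -map_rev -map_comp.
by apply: eq_map => c; rewrite /shift /= addnC.
Qed.

Lemma mem_seg r a k b : (b \in seg r a k) = (b.1 == r) && (a <= b.2 < a + k).
Proof.
apply/mapP/andP => [[c]|[/eqP <- h]].
  by rewrite mem_rev mem_iota => h -> /=.
by exists b.2; [rewrite mem_rev mem_iota|case: (b)].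
Qed.

Lemma size_seg r a k : size (seg r a k) = k.
Proof. by rewrite size_map size_rev size_iota. Qed.

Definition row_boxes (T : filling) r := seg r 0 (size (nth [::] T r)).

Lemma rd_boxes_split n T i : size T = n -> 0 < i < n ->
  rd_boxes T = flatten (map (row_boxes T) (iota 0 (n - i.+1))) ++
    row_boxes T (n - i.+1) ++ row_boxes T (n - i) ++
    flatten (map (row_boxes T) (iota (n - i).+1 i.-1)).
Proof.
move=> sT iN; rewrite -[rd_boxes T]/(flatten (map (row_boxes T) (iota 0 (size T)))) sT.
have -> : iota 0 n = iota 0 (n - i.+1) ++ (n - i.+1) :: (n - i) :: iota (n - i).+1 i.-1.
  rewrite {1}(_ : n = (n - i.+1) + i.-1.+2); last lia.
  rewrite iotaD /= add0n; congr (_ ++ _ :: _ :: iota _ _); lia.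
by rewrite map_cat flatten_cat.
Qed.

Lemma reduced_filter (A : eqType) (l : A -> nat) i s :
  reduced l i [seq b <- s | letter i (l b)] = reduced l i s.
Proof. by rewrite /reduced filter_id. Qed.

Lemma filter_letter_none (A :
  eqType) (l : A -> nat) i s : (forall b, b \in s -> ~~ letter i (l b)) ->
  [seq b <- s | letter i (l b)] = [::].
Proof. by move=> h; apply/eqP; rewrite -[_ == _]negbK -has_filter; apply/hasPn. Qed.

Lemma entry_seg T r c : entry T (r, c) = nth 0 (nth [::] T r) c.
Proof. by []. Qed.

Lemma entry_brow n T j c : entry T (n - j, c) = nth 0 (brow n T j) c.
Proof. by []. Qed.

(** In a semistandard tableau the initial run of the row [i.+1] matches all
    letters [i] of the row below.  This is why boxes added on the left
    contribute unmatched letters [i.+1] and do not disturb the signature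
    otherwise. *)
Definition low_matched n i (T : filling) : Prop :=
  bounded n T /\ count_mem i (brow n T i) <= run i.+1 (brow n T i.+1).

(** The part of rd that precedes the initial run of the row [i.+1].  Behind it
    rd_i consists of that run and of the letters [i] of the row [i]. *)
Definition upper n i (T : filling) : seq box :=
  flatten (map (row_boxes T) (iota 0 (n - i.+1))) ++
  seg (n - i.+1) (run i.+1 (brow n T i.+1))
    (size (brow n T i.+1) - run i.+1 (brow n T i.+1)).

(** The letters [i] of the row [i] are cancelled by the last boxes of the
    initial run in rd, and its other boxes survive. *)
Lemma rdbar_upper n i T : 0 < i < n -> low_matched n i T ->
  rdbar_i i T = reduced (entry T) i (upper n i T) ++
    seg (n - i.+1) (count_mem i (brow n T i))
      (run i.+1 (brow n T i.+1) - count_mem i (brow n T i)).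
Proof.
move=> iN [[sT bd] cd]; rewrite rdbar_reduced (rd_boxes_split sT iN).
set d := run _ _ in cd *; set c := count_mem _ _ in cd *.
have ds : d <= size (brow n T i.+1) by exact: run_le.
rewrite /row_boxes -[nth [::] T (n - i.+1)]/(brow n T i.+1).
rewrite {1}(_ : size (brow n T i.+1) = d + (size (brow n T i.+1) - d)); last lia.
rewrite segD add0n -catA catA -/(upper n i T) -/(row_boxes T (n - i)).
have DS : all (is_high (entry T) i) (seg (n - i.+1) 0 d).
  apply/allP => -[r k]; rewrite mem_seg /= => /andP[/eqP -> kd].
  by rewrite /is_high entry_brow (@nth_run i.+1).
set L := flatten _.
pose E0 := [seq b <- row_boxes T (n - i) | letter i (entry T b)].
have szE0 : size E0 = c.
  rewrite size_filter /c -[brow n T i](mkseq_nth 0) count_map /row_boxes /seg count_map count_rev.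
  apply: eq_in_count => k; rewrite mem_iota /= add0n => kb.
  rewrite entry_brow; have /(all_nthP 0) /(_ k kb) := bd i ltac:(lia).
  by rewrite /letter; lia.
have EI : all (is_low (entry T) i) E0.
  apply/allP => -[r k]; rewrite mem_filter mem_seg /= => /andP[h /andP[/eqP rE kb]].
  move: h; rewrite rE /is_low entry_brow; have /(all_nthP 0) /(_ k kb) := bd i ltac:(lia).
  by rewrite /letter; lia.
have -> : seg (n - i.+1) c (d - c) = take (d - c) (seg (n - i.+1) 0 d).
  rewrite [in RHS](_ : d = c + (d - c)); last lia.
  by rewrite segD add0n takel_cat ?size_seg ?take_oversize ?size_seg //; lia.
have -> : reduced (entry T) i (upper n i T ++ seg (n - i.+1) 0 d ++ row_boxes T (n - i) ++ L) =
          reduced (entry T) i (upper n i T ++ (seg (n - i.+1) 0 d ++ E0)).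
  rewrite -reduced_filter -[RHS]reduced_filter !filter_cat filter_id; congr (reduced _ _ (_ ++ _ ++ _)).
  rewrite [X in _ ++ X]filter_letter_none ?cats0 // => -[r k] /flattenP[s /mapP[r']].
  rewrite mem_iota => r'b ->; rewrite mem_seg /= => /andP[/eqP -> kb].
  have := bd (n - r') ltac:(lia); rewrite /brow (_ : n - (n - r') = r'); last lia.
  move=> /(all_nthP 0) /(_ k kb); rewrite /letter entry_seg; lia.
have rE : reduced (entry T) i (seg (n - i.+1) 0 d ++ E0) = take (d - c) (seg (n - i.+1) 0 d).
  by rewrite reduced_high_low ?szE0 ?size_seg.
by rewrite reduced_cat_high rE //; apply/allP => b /mem_take; exact: (allP DS).
Qed.

Lemma upper_sub n i T : size T = n -> 0 < i < n -> {subset upper n i T <= rd_boxes T}.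
Proof.
move=> sT iN [r k]; rewrite mem_cat mem_rd_boxes sT /=.
case/orP => [/flattenP[s /mapP[r']]|].
  by rewrite mem_iota => r'b ->; rewrite mem_seg /= => /andP[/eqP -> kb]; apply/andP; split; lia.
rewrite mem_seg /= => /andP[/eqP -> kb]; apply/andP; split; first lia.
by rewrite /brow in kb; lia.
Qed.

Lemma bounded_add n m T : bounded n T -> bounded n (add_left n m T).
Proof.
move=> [sT bd]; split=> [|j jn]; rewrite ?size_add_left // brow_add_left // all_cat bd //.
by rewrite andbT all_nseq; lia.
Qed.

Lemma filter_upper_add n i m T : 0 < i < n -> bounded n T ->
  [seq b <- upper n i (add_left n m T) | letter i (entry (add_left n m T) b)] =
  map (shift m) [seq b <- upper n i T | letter i (entry T b)].
Proof.
move=> iN [sT bd]; set E := add_left n m T.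
have -> : [seq b <- upper n i T | letter i (entry T b)] =
          [seq b <- upper n i T | letter i (entry E (shift m b))].
  apply: eq_in_filter => b /(upper_sub sT iN); rewrite mem_rd_boxes sT => /andP[bn _].
  by rewrite /= entry_shift.
rewrite -(filter_map (shift m) (fun b => letter i (entry E b))).
rewrite /upper map_cat !filter_cat; congr (_ ++ _).
  rewrite map_flatten !filter_flatten -!map_comp; congr flatten.
  apply/eq_in_map => r; rewrite mem_iota /= => rb.
  rewrite /row_boxes nth_add_left ?size_cat ?size_nseq; last lia.
  rewrite segD add0n filter_cat map_shift_seg add0n.
  rewrite [X in _ ++ X]filter_letter_none ?cats0 // => -[r' k]; rewrite mem_seg /= => /andP[/eqP -> kb].
  rewrite entry_seg nth_add_left ?nth_cat ?size_nseq; last lia.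
  have km : k < m r.+1 by lia.
  by rewrite km nth_nseq km /letter; lia.
rewrite map_shift_seg brow_add_left; last lia.
by rewrite run_nseq_cat size_cat size_nseq; congr [seq _ <- seg _ _ _ | _]; lia.
Qed.

Lemma reduced_upper_add n i m T : 0 < i < n -> bounded n T ->
  reduced (entry (add_left n m T)) i (upper n i (add_left n m T)) =
  map (shift m) (reduced (entry T) i (upper n i T)).
Proof.
move=> iN bT; have [sT _] := bT; rewrite -reduced_filter filter_upper_add // reduced_map.
have -> : reduced (entry T) i (upper n i T) = reduced (entry T) i [seq b <- upper n i T | letter i (entry T b)].
  by rewrite reduced_filter.
congr map; apply: eq_reduced => b; rewrite mem_filter => /andP[_ /(upper_sub sT iN)].
by rewrite mem_rd_boxes sT => /andP[bn _]; rewrite /= entry_shift.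
Qed.

(** Of the added boxes, the [i]'s cancel as many [i.+1]'s of the longer run, and
    the remaining [i.+1]'s stay at the end of the signature. *)
Lemma rdbar_add n i m T : 0 < i < n -> low_matched n i T -> m (n - i).+1 <= m (n - i) ->
  rdbar_i i (add_left n m T) =
  map (shift m) (rdbar_i i T) ++
  seg (n - i.+1) (count_mem i (brow n T i) + m (n - i).+1) (m (n - i) - m (n - i).+1).
Proof.
move=> iN gT hm; have [bT cd] := gT.
have nE : (n - i.+1).+1 = n - i by lia.
have cE : count_mem i (brow n (add_left n m T) i) = m (n - i).+1 + count_mem i (brow n T i).
  by rewrite brow_add_left ?count_cat ?count_nseq /= ?eqxx ?mul1n //; lia.
have dE : run i.+1 (brow n (add_left n m T) i.+1) = m (n - i) + run i.+1 (brow n T i.+1).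
  by rewrite brow_add_left ?run_nseq_cat ?nE //; lia.
have gE : low_matched n i (add_left n m T).
  by split; [exact: bounded_add|rewrite cE dE; lia].
rewrite (rdbar_upper iN gE) (rdbar_upper iN gT) reduced_upper_add // map_cat -catA.
congr (_ ++ _); rewrite cE dE map_shift_seg nE.
set c := count_mem _ _ in cd *; set d := run _ _ in cd *.
rewrite (_ : m (n - i) + d - _ = (m (n - i) - m (n - i).+1) + (d - c)); last lia.
by rewrite segD; congr (seg _ _ _ ++ seg _ _ _); lia.
Qed.

Lemma rdbar_extra n i m T b : 0 < i < n -> low_matched n i T ->
  b \in seg (n - i.+1) (count_mem i (brow n T i) + m (n - i).+1) (m (n - i) - m (n - i).+1) ->
  entry (add_left n m T) b = i.+1.
Proof.
move=> iN [_]; set c := count_mem _ _; set d := run _ _ => cd; case: b => r k.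
rewrite mem_seg /= => /andP[/eqP -> kb]; rewrite entry_brow; apply: nth_run.
rewrite brow_add_left ?run_nseq_cat; last lia.
by rewrite -/d (_ : (n - i.+1).+1 = n - i); lia.
Qed.

(** * Operators and added boxes *)

(** The condition under which the values of an operator persist when boxes are
    added on the left.  For \bar 1 it keeps the changed box out of the bottom
    row, in front of which letters 1 are added. *)
Definition extensible n (i : Iq n) (T : filling) : Prop :=
  if i is Some j then low_matched n j T
  else bounded n T /\ (0 < size (brow n T 1) -> 0 < size (brow n T 2)).

(** The condition under which the value 0 persists too.  With the strict
    inequality e_i does not vanish at all; a box in the second row from the
    bottom makes rd_1 nonempty. *)
Definition strictly_extensible n (i : Iq n) (T : filling) : Prop :=
  bounded n T /\
  if i is Some j then count_mem (idx j) (brow n T j) < run j.+1 (brow n T j.+1)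
  else 0 < size (brow n T 2).

Lemma strictly_extensibleW n (i : Iq n) T : strictly_extensible i T -> extensible i T.
Proof. by case: i => [j|] [bT h]; split=> //; exact: ltnW. Qed.

(** The number [m k] of boxes added to the [k]-th row from the top has to decrease
    with [k], like the parts of an element of Lambda^-. *)
Definition mono n (m : nat -> nat) : Prop :=
  forall j, 0 < j < n -> m (n - j).+1 <= m (n - j).

Lemma filter_rdbar_add n i m T a : 0 < i < n -> low_matched n i T -> mono n m ->
  [seq b <- rdbar_i i (add_left n m T) | entry (add_left n m T) b == a] =
  map (shift m) [seq b <- rdbar_i i T | entry T b == a] ++
  if a == i.+1 then seg (n - i.+1) (count_mem i (brow n T i) + m (n - i).+1)
                      (m (n - i) - m (n - i).+1) else [::].
Proof.
move=> iN gT hm; rewrite rdbar_add ?hm // filter_cat filter_map; congr (map _ _ ++ _).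
  apply: eq_in_filter => b /=; rewrite rdbar_reduced => /reduced_mem.
  by rewrite mem_rd_boxes (proj1 (proj1 gT)) => /andP[bn _]; rewrite entry_shift.
set s := seg _ _ _; have sE b : b \in s -> entry (add_left n m T) b = i.+1.
  exact: rdbar_extra.
case: eqP => [->|ai].
  by apply/all_filterP/allP => b /sE ->.
by apply/eqP; rewrite -[_ == _]negbK -has_filter; apply/hasPn => b /sE ->; apply/eqP => /esym.
Qed.

Lemma rdbar_mem i T : {subset rdbar_i i T <= rd_boxes T}.
Proof. by move=> b; rewrite rdbar_reduced => /reduced_mem. Qed.

Lemma omap_set_shift n m T x s : size T = n -> {subset s <= rd_boxes T} ->
  omap (fun b => set_entry (add_left n m T) b x) (ohead (map (shift m) s)) =
  omap (add_left n m) (omap (fun b => set_entry T b x) (ohead s)).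
Proof.
move=> sT; case: s => //= b s h; congr Some; rewrite add_left_set //.
by apply: h; rewrite mem_head.
Qed.

Lemma change_f_add n i m T : 0 < i < n -> low_matched n i T -> mono n m ->
  change_f i (add_left n m T) = omap (add_left n m) (change_f i T).
Proof.
move=> iN gT hm; rewrite /change_f filter_rdbar_add //.
have -> : (i == i.+1) = false by lia.
rewrite cats0 -map_rev omap_set_shift ?(proj1 (proj1 gT)) // => b.
by rewrite mem_rev mem_filter => /andP[_ /rdbar_mem].
Qed.

Lemma change_e_add n i m T T' : 0 < i < n -> low_matched n i T -> mono n m ->
  change_e i T = Some T' -> change_e i (add_left n m T) = Some (add_left n m T').
Proof.
move=> iN gT hm; rewrite /change_e filter_rdbar_add // eqxx.
set s := [seq b <- _ | _] => h.
have sub : {subset s <= rd_boxes T} by move=> b; rewrite mem_filter => /andP[_ /rdbar_mem].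
have := @omap_set_shift n m T i s (proj1 (proj1 gT)) sub.
by rewrite h /=; case: (s) h => //.
Qed.

(** A box of the initial run survives the cancellation. *)
Lemma change_e_some n i T : 0 < i < n -> low_matched n i T ->
  count_mem i (brow n T i) < run i.+1 (brow n T i.+1) -> change_e i T <> None.
Proof.
move=> iN gT; set c := count_mem _ _; set d := run _ _ => cd.
rewrite /change_e.
have : (n - i.+1, c) \in [seq b <- rdbar_i i T | entry T b == i.+1].
  rewrite mem_filter (rdbar_upper iN gT) mem_cat mem_seg /= eqxx -/c -/d.
  by rewrite entry_brow (@nth_run i.+1) //; lia.
by case: [seq b <- _ | _].
Qed.

Lemma active1_add n m T b : 1 < n -> @extensible n None T ->
  @active n None T b -> @active n None (add_left n m T) (shift m b).
Proof.
move=> n1 [[sT bd] h12] /=.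
have iN : 0 < 1 < n by lia.
have bT : bounded n T by [].
have rdE U : bounded n U -> rd_i 1 U = [seq b <- upper n 1 U | letter 1 (entry U b)] ++
    seg (n - 2) 0 (run 2 (brow n U 2)) ++ row_boxes U (n - 1).
  move=> [sU bU]; have := run_le 2 (brow n U 2); set d := run _ _ => dU.
  have rE : row_boxes U (n - 2) = seg (n - 2) d (size (brow n U 2) - d) ++ seg (n - 2) 0 d.
    rewrite /row_boxes -[nth [::] U (n - 2)]/(brow n U 2).
    by rewrite {1}(_ : size (brow n U 2) = d + (size (brow n U 2) - d)) ?segD ?add0n //; lia.
  rewrite /rd_i (rd_boxes_split sU iN) /= cats0 rE.
  rewrite -catA catA -/(upper n 1 U) !filter_cat; congr (_ ++ (_ ++ _)).
    apply/all_filterP/allP => -[r k]; rewrite mem_seg /= => /andP[/eqP -> kd].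
    by rewrite entry_brow (@nth_run 2).
  apply/all_filterP/allP => -[r k]; rewrite mem_seg /= => /andP[/eqP -> kd].
  have /(all_nthP 0) /(_ k kd) := bU 1 ltac:(lia).
  by rewrite entry_brow; lia.
rewrite (rdE _ bT) (rdE _ (bounded_add m bT)) filter_upper_add //.
case F: [seq b <- upper n 1 T | letter 1 (entry T b)] => [|c s] /=; last by case=> ->.
rewrite brow_add_left ?run_nseq_cat; last lia.
rewrite (_ : (n - 2).+1 = n - 1); last lia.
case E: (run 2 (brow n T 2)) => [|d] /=; last first.
  have hd r k : ohead (seg r 0 k.+1 ++ row_boxes T (n - 1)) = Some (r, k).
    by rewrite /seg -addn1 iotaD rev_cat.
  have hd' r k u : ohead (seg r 0 k.+1 ++ u) = Some (r, k).
    by rewrite /seg -addn1 iotaD rev_cat.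
  rewrite addnS !hd' => -[<-]; rewrite /shift /= (_ : (n - 2).+1 = n - 1) 1?addnC //; lia.
have sz2 : size (brow n T 2) = 0.
  case: (posnP (size (brow n T 2))) => // s2.
  have : (n - 2, 0) \in [seq b <- upper n 1 T | letter 1 (entry T b)].
    rewrite mem_filter mem_cat mem_seg E /= eqxx subn0 s2 orbT andbT entry_brow.
    by have /(all_nthP 0) /(_ 0 s2) := bd 2 ltac:(lia); rewrite /letter; lia.
  by rewrite F.
by rewrite /row_boxes -[nth _ _ _]/(brow n T 1) (_ : size (brow n T 1) = 0) //; lia.
Qed.

Lemma low_bounds n (i : Iq n) : 1 < n -> 0 < low i < n.
Proof. by case: i => [[j /= jn]|]. Qed.

Lemma extensible_bounded n (i : Iq n) T : extensible i T -> bounded n T.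
Proof. by case: i => [j|] []. Qed.

Lemma sdt_e_add n (i : Iq n) m T T' : 1 < n -> extensible i T -> mono n m ->
  sdt_e i T = Some T' -> sdt_e i (add_left n m T) = Some (add_left n m T').
Proof.
move=> n1 gT hm; have [sT _] := extensible_bounded gT.
case: i gT => [[j jn]|] gT; first exact: change_e_add.
move=> /sdt_eP[b [act bE ->]]; apply/sdt_eP; exists (shift m b).
have bT := active_mem act; split; first exact: active1_add.
  by rewrite entry_shift //; move: bT; rewrite mem_rd_boxes sT => /andP[].
by rewrite add_left_set.
Qed.

Lemma sdt_f_add n (i : Iq n) m T T' : 1 < n -> extensible i T -> mono n m ->
  sdt_f i T = Some T' -> sdt_f i (add_left n m T) = Some (add_left n m T').
Proof.
move=> n1 gT hm; have [sT _] := extensible_bounded gT.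
case: i gT => [[j jn]|] gT.
  by move=> /= h; rewrite change_f_add //= h.
move=> /sdt_fP[b [act bE ->]]; apply/sdt_fP; exists (shift m b).
have bT := active_mem act; split; first exact: active1_add.
  by rewrite entry_shift //; move: bT; rewrite mem_rd_boxes sT => /andP[].
by rewrite add_left_set.
Qed.

Lemma active1_ex n T : 1 < n -> @strictly_extensible n None T -> exists b, @active n None T b.
Proof.
move=> n1 [[sT bd] s2] /=.
have : (n - 2, 0) \in rd_i 1 T.
  rewrite mem_filter mem_rd_boxes /= sT -/(brow n T 2) s2 andbT entry_brow.
  by have /(all_nthP 0) /(_ 0 s2) := bd 2 ltac:(lia); lia.
by case: (rd_i 1 T) => // b s _; exists b.
Qed.

Lemma sdt_e_add_full n (i : Iq n) m T : 1 < n -> strictly_extensible i T -> mono n m ->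
  sdt_e i (add_left n m T) = omap (add_left n m) (sdt_e i T).
Proof.
move=> n1 vT hm; have gT := strictly_extensibleW vT.
case E: (sdt_e i T) => [T'|] /=; first exact: sdt_e_add.
case: i vT gT E => [[j jn]|] vT gT E; first by case: (change_e_some jn gT (proj2 vT)).
have [b act] := active1_ex n1 vT.
case F: (change_e1bar (add_left n m T)) => [U|] //.
have /(@sdt_eP n None)[c [act' cE _]] := F.
have := active1_add m n1 gT act; move: act' => /= -> [bc].
have : @sdt_e n None T = Some (set_entry T b 1).
  apply/sdt_eP; exists b; split=> //; move: cE; rewrite bc entry_shift //.
  by have := active_mem act; rewrite mem_rd_boxes (proj1 (proj1 vT)) => /andP[].
by rewrite E.
Qed.

Lemma sdt_f_add_full n (i : Iq n) m T : 1 < n -> strictly_extensible i T -> mono n m ->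
  sdt_f i (add_left n m T) = omap (add_left n m) (sdt_f i T).
Proof.
move=> n1 vT hm; have gT := strictly_extensibleW vT.
case: i vT gT => [[j jn]|] vT gT; first exact: change_f_add.
case E: (sdt_f None T) => [T'|] /=; first exact: (@sdt_f_add n None).
have [b act] := active1_ex n1 vT.
case F: (change_f1bar (add_left n m T)) => [U|] //.
have /(@sdt_fP n None)[c [act' cE _]] := F.
have := active1_add m n1 gT act; move: act' => /= -> [bc].
have : @sdt_f n None T = Some (set_entry T b 2).
  apply/sdt_fP; exists b; split=> //; move: cE; rewrite bc entry_shift //.
  by have := active_mem act; rewrite mem_rd_boxes (proj1 (proj1 vT)) => /andP[].
by rewrite E.
Qed.

(** Tableaux with the same cores have a common extension, and extending commutes
    with the operators; so the operators are determined by the cores. *)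
Lemma sdt_e_core n (i : Iq n) T U T' U' : 1 < n -> extensible i T -> extensible i U ->
  same_core n T U -> sdt_e i T = Some T' -> sdt_e i U = Some U' -> same_core n T' U'.
Proof.
move=> n1 gT gU /same_core_ext[m [m' [E mT mU]]] eT eU.
have := sdt_e_add n1 gT mT eT; rewrite E (sdt_e_add n1 gU mU eU) => -[/esym].
exact: same_core_add.
Qed.

Lemma sdt_f_core n (i : Iq n) T U T' U' : 1 < n -> extensible i T -> extensible i U ->
  same_core n T U -> sdt_f i T = Some T' -> sdt_f i U = Some U' -> same_core n T' U'.
Proof.
move=> n1 gT gU /same_core_ext[m [m' [E mT mU]]] eT eU.
have := sdt_f_add n1 gT mT eT; rewrite E (sdt_f_add n1 gU mU eU) => -[/esym].
exact: same_core_add.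
Qed.

Lemma sdt_e_core_ex n (i : Iq n) T U T' : 1 < n -> extensible i T -> strictly_extensible i U ->
  same_core n T U -> sdt_e i T = Some T' ->
  exists2 U', sdt_e i U = Some U' & same_core n T' U'.
Proof.
move=> n1 gT vU h; have [m [m' [E mT mU]]] := same_core_ext h; move=> eT.
have := sdt_e_add n1 gT mT eT; rewrite E sdt_e_add_full //.
case eU: (sdt_e i U) => [U'|] // _; exists U' => //.
exact: sdt_e_core (strictly_extensibleW vU) h eT eU.
Qed.

Lemma sdt_f_core_ex n (i : Iq n) T U T' : 1 < n -> extensible i T -> strictly_extensible i U ->
  same_core n T U -> sdt_f i T = Some T' ->
  exists2 U', sdt_f i U = Some U' & same_core n T' U'.
Proof.
move=> n1 gT vU h; have [m [m' [E mT mU]]] := same_core_ext h; move=> eT.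
have := sdt_f_add n1 gT mT eT; rewrite E sdt_f_add_full //.
case eU: (sdt_f i U) => [U'|] // _; exists U' => //.
exact: sdt_f_core (strictly_extensibleW vU) h eT eU.
Qed.

(** * Dual marginally large tableaux *)

Definition hook_filling n (T : filling) : Prop :=
  size T = n /\ forall j, 0 < j <= n ->
    hook_word (brow n T j) /\ all (fun a => 0 < a <= j) (brow n T j).

(** By [SDT_infP] these are the dual marginally large tableaux: the long initial
    runs make semistandardness a condition on single rows. *)
Definition dml_filling n (T : filling) : Prop :=
  hook_filling n T /\ forall j, 0 < j <= n -> run j (brow n T j) = (size (brow n T j.-1)).+1.

Lemma hook_filling_bounded n T : hook_filling n T -> bounded n T.
Proof. by move=> [sT h]; split=> // j /h[]. Qed.

Lemma dml_strictly_extensible n (i : Iq n) T : 1 < n -> dml_filling n T -> strictly_extensible i T.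
Proof.
move=> n1 [pT rT]; split; first exact: hook_filling_bounded.
case: i => [[j jn]|].
  rewrite rT /=; last lia.
  by rewrite ltnS count_size.
have := rT 2 ltac:(lia); have := run_le 2 (brow n T 2); lia.
Qed.

Lemma dmlP n T : size T = n ->
  reflect (forall j, 0 < j <= n -> run j (brow n T j) = (size (brow n T j.-1)).+1)
          (dual_marginally_large n T).
Proof.
move=> sT; rewrite /dual_marginally_large sT eqxx /=.
have E j : 0 < j <= n -> trow T (n - j).+1 = brow n T j /\ trow T (n - j).+2 = brow n T j.-1.
  by move=> jn; rewrite /trow /brow /=; split=> //; congr nth; lia.
apply: (iffP allP) => [h j jn|h j].
  have [e1 e2] := E j jn; rewrite -e1 -e2; apply/eqP/h; rewrite mem_iota; lia.
by rewrite mem_iota => jn; have [|-> ->] := E j; [lia|apply/eqP/h; lia].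
Qed.

Lemma brow0 n T : size T = n -> brow n T 0 = [::].
Proof. by move=> sT; rewrite /brow subn0 nth_default ?sT. Qed.

(** The length of each initial run is given by the row below, so the rows can be
    recovered from the cores one after the other. *)
Lemma dml_filling_inj n T U : dml_filling n T -> dml_filling n U -> same_core n T U -> T = U.
Proof.
move=> [[sT _] rT] [[sU _] rU] h; apply: (@brow_ext n) => //.
suff H j : j <= n -> brow n T j = brow n U j by move=> j /andP[_ /H].
elim: j => [|j IH] jn; first by rewrite !brow0.
rewrite [LHS](run_cat_drop j.+1) [RHS](run_cat_drop j.+1).
rewrite -/(core n T j.+1) -/(core n U j.+1) h; last lia.
by rewrite rT ?rU /= ?IH //; lia.
Qed.

Lemma run_set_after j u c x : c < size u -> run j u <= c ->
  (c = run j u -> x != j) -> run j (set_nth 0 u c x) = run j u.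
Proof.
move=> cu rc xj; have sz : size (set_nth 0 u c x) = size u.
  by rewrite size_set_nth; apply/maxn_idPr.
apply: run_eq => [|k kr|]; rewrite ?sz ?run_le // nth_set_nth /=.
  case: (k =P c) => [kc|_]; first lia.
  exact: nth_run.
by case: (run j u =P c) => [/esym/xj //|_]; exact: nth_run_stop.
Qed.

Lemma rd_1_pos n T b : 1 < n -> bounded n T -> 0 < size (brow n T 2) ->
  @active n None T b -> b.1 < n - 2 \/ b = (n - 2, (size (brow n T 2)).-1).
Proof.
move=> n1 [sT bd] s2 /=; rewrite /rd_i (@rd_boxes_split n T 1 sT n1) !filter_cat.
case F: [seq b <- flatten _ | _] => [|c s] /=; last first.
  case=> <-; left; have : c \in c :: s by rewrite mem_head.
  rewrite -F mem_filter => /andP[_ /flattenP[t /mapP[r]]].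
  rewrite mem_iota => rn ->; case: (c) => r' k.
  by rewrite mem_seg /= => /andP[/eqP -> _]; lia.
have -> : [seq b <- row_boxes T (n - 2) | (entry T b == 1) || (entry T b == 2)] = row_boxes T (n - 2).
  apply/all_filterP/allP => -[r k]; rewrite mem_seg /= => /andP[/eqP -> kd].
  by have /(all_nthP 0) /(_ k kd) := bd 2 ltac:(lia); rewrite entry_brow; lia.
rewrite /row_boxes -[nth [::] T (n - 2)]/(brow n T 2); case: (size _) s2 => // k _.
by rewrite /seg -[k.+1]addn1 iotaD rev_cat /= => -[<-]; right; rewrite addn1.
Qed.

(** Letters [low i] occur only in the row that they start, where the run of the
    row above matches them all, and higher up.  So the changed box lies above
    that row; in the row starting with [(low i).+1] it is the last box of the
    initial run or a box behind it. *)
Lemma active_pos n (i : Iq n) T r c : 1 < n -> dml_filling n T -> active i T (r, c) ->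
  letter (low i) (entry T (r, c)) ->
  r <= n - (low i).+1 /\
  (r = n - (low i).+1 -> let u := brow n T (low i).+1 in
      [/\ entry T (r, c) = (low i).+1 -> c.+1 = run (low i).+1 u \/ run (low i).+1 u < c,
          entry T (r, c) = low i -> run (low i).+1 u <= c &
          c.+1 < size u -> nth 0 u c.+1 != (low i).+1]).
Proof.
move=> n1 oT act lE; have vT := dml_strictly_extensible i n1 oT; have gT := strictly_extensibleW vT.
have iN := low_bounds i n1.
have := active_mem act; rewrite mem_rd_boxes /= => /andP[_ cs].
have stop : r = n - (low i).+1 -> c = run (low i).+1 (brow n T (low i).+1) ->
    entry T (r, c) <> (low i).+1.
  move=> rE cE; rewrite rE entry_brow cE; apply/eqP/nth_run_stop.
  by rewrite -cE /brow -rE.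
case: i act lE vT gT iN stop => [[l ln]|] act lE vT gT iN stop; last first.
  rewrite /= in lE stop *.
  case: (rd_1_pos n1 (proj1 vT) (proj2 vT) act) => /= [rn|[rE cE]].
    by split=> [|rE]; lia.
  split=> [|_]; first lia.
  have du := run_le 2 (brow n T 2); split=> [e2|e1|]; last by rewrite cE; lia.
    by have := stop rE; move: e2 du; rewrite cE; case: (size _) => /=; lia.
  rewrite leqNgt; apply/negP => cd; move: e1; rewrite rE entry_brow.
  by rewrite (@nth_run 2).
have nx := signature_box_next act; rewrite /= in lE stop nx *.
have bR : (r, c) \in rdbar_i l T.
  have [s1 [s2 [E h1 h2]]] := act.
  by rewrite rdbar_reduced E reduced_join // mem_cat mem_head orbT.
move: bR; rewrite (rdbar_upper ln gT) mem_cat mem_seg /=.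
case/orP => [/reduced_mem|/andP[/eqP rE cb]]; last first.
  rewrite rE in nx *; split=> // _.
  have ce : entry T (n - l.+1, c) = l.+1 by rewrite entry_brow (@nth_run l.+1) //; lia.
  split=> [_||]; [left|by rewrite ce; lia|exact: nx].
  case: (ltnP c.+1 (run l.+1 (brow n T l.+1))) => [h|]; last lia.
  have := nx (leq_trans h (run_le _ _)).
  by rewrite entry_brow (nth_run h) eqxx.
rewrite mem_cat mem_seg /= => /orP[/flattenP[s /mapP[r']]|/andP[/eqP rE cb]].
  rewrite mem_iota => r'n ->; rewrite mem_seg /= => /andP[/eqP rE _].
  by split=> [|h]; lia.
split=> [|_]; first lia.
split=> [e1|e1|]; [right|lia|by rewrite rE in nx].
by have := stop rE; lia.
Qed.

(** A box that is missing in the initial run of the row [l.+1] is made up for by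
    one more box in this row and in all rows above: these runs have to grow
    because the rows below them do. *)
Lemma restore_e_inf n l T : hook_filling n T -> 0 < l < n ->
  (forall j, 0 < j <= n -> j != l.+1 -> run j (brow n T j) = (size (brow n T j.-1)).+1) ->
  run l.+1 (brow n T l.+1) = (size (brow n T l)).+1 \/
  run l.+1 (brow n T l.+1) = size (brow n T l) ->
  dml_filling n (restore_e n l T) /\ same_core n (restore_e n l T) T.
Proof.
move=> [sT pT] ln rT rl; rewrite /restore_e; case: (dmlP sT) => dT.
  by split=> //; split.
have {}rl : run l.+1 (brow n T l.+1) = size (brow n T l).
  case: rl => // rl; case: dT => j jn; case: (j =P l.+1) => [->//|/eqP jl].
  exact: rT.
split=> [|j jn]; last by rewrite core_add_left.
have rwE j : 0 < j <= n ->
    brow n (add_left n (fun k => (k <= n - l)%N) T) j = nseq (l < j) j ++ brow n T j.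
  by move=> jn; rewrite brow_add_left //; congr (nseq (nat_of_bool _) _ ++ _); lia.
split; [split|]; first by rewrite size_add_left.
  move=> j jn; rewrite rwE //; have [hk bd] := pT j jn; split; last first.
    by rewrite all_cat all_nseq bd andbT; lia.
  case: ltnP => //= _; apply: hook_cons hk _.
  by case: (brow n T j) bd => [|a u] //= /andP[/andP[]].
move=> j jn; rewrite rwE // run_nseq_cat.
have -> : size (brow n (add_left n (fun k => (k <= n - l)%N) T) j.-1) =
          (l < j.-1) + size (brow n T j.-1).
  case: (posnP j.-1) => j0; last by rewrite rwE ?size_cat ?size_nseq //; lia.
  by rewrite j0 !brow0 ?size_add_left.
case: (j =P l.+1) => [->|/eqP jl]; first by rewrite /= rl ltnSn ltnn.
by rewrite rT //; lia.
Qed.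

Lemma restore_f_inf n l T : hook_filling n T -> 0 < l < n ->
  (forall j, 0 < j <= n -> j != l.+1 -> run j (brow n T j) = (size (brow n T j.-1)).+1) ->
  run l.+1 (brow n T l.+1) = (size (brow n T l)).+1 \/
  run l.+1 (brow n T l.+1) = (size (brow n T l)).+2 ->
  dml_filling n (restore_f n l T) /\ same_core n (restore_f n l T) T.
Proof.
move=> [sT pT] ln rT rl; rewrite /restore_f; case: (dmlP sT) => dT.
  by split=> //; split.
have {}rl : run l.+1 (brow n T l.+1) = (size (brow n T l)).+2.
  case: rl => // rl; case: dT => j jn; case: (j =P l.+1) => [->//|/eqP jl].
  exact: rT.
set m : nat -> nat := fun k => (k <= n - l)%N.
have rwE j : 0 < j <= n -> brow n (remove_left n m T) j = drop (l < j) (brow n T j).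
  by move=> jn; rewrite brow_remove_left //; congr (drop (nat_of_bool _) _); lia.
have sR : size (remove_left n m T) = n by rewrite size_map size_iota.
have ne j : 0 < j <= n -> 0 < size (brow n T j).
  by move=> /pT[/hook_wordP[]]; case: (brow n T j).
have r2 j : 0 < j <= n -> l < j -> 1 < run j (brow n T j).
  move=> jn lj; case: (j =P l.+1) => [->|/eqP jl]; first by rewrite rl.
  by rewrite rT // ltnS ne //; lia.
have addK : T = add_left n m (remove_left n m T).
  apply: (@brow_ext n); rewrite ?size_add_left // => j jn.
  rewrite brow_add_left // rwE //.
  have -> : m (n - j).+1 = (l < j) by rewrite /m; congr nat_of_bool; lia.
  case: (ltnP l j) => //= lj; last by rewrite drop0.
  have := r2 j jn lj; case: (brow n T j) => [|a u] //=; rewrite drop0 /run /=.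
  by case: eqP => [->|].
split=> [|j jn]; last by rewrite [in RHS]addK core_add_left.
split; [split=> // j jn|].
  have [hk bd] := pT j jn; rewrite rwE //; split; last first.
    by apply/allP => a /mem_drop; exact: (allP bd).
  apply: hook_drop hk _; have := run_le j (brow n T j); have := ne j jn.
  by case: (ltnP l j) => // lj; have := r2 j jn lj; lia.
have szE j : 0 < j <= n -> size (brow n T j.-1) = (l < j.-1) + size (brow n (remove_left n m T) j.-1).
  move=> jn; case: (posnP j.-1) => j0; first by rewrite j0 !brow0.
  rewrite rwE ?size_drop; last lia.
  by have := ne j.-1 ltac:(lia); lia.
move=> j jn; have rE : run j (brow n T j) = (l < j) + run j (brow n (remove_left n m T) j).
  rewrite [in LHS]addK brow_add_left // run_nseq_cat; congr (_ + _).
  by rewrite /m; congr nat_of_bool; lia.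
have := szE j jn; case: (j =P l.+1) => [jE|/eqP jl].
  by rewrite jE /= in rE *; lia.
by have := rT j jn jl; lia.
Qed.

Section Step.
Variables (n : nat) (i : Iq n) (T : filling) (r c x : nat).
Hypotheses (n1 : 1 < n) (oT : dml_filling n T) (act : active i T (r, c))
  (lE : letter (low i) (entry T (r, c))) (lx : letter (low i) x).

Let T' := set_entry T (r, c) x.

Lemma step_brow j : 0 < j <= n ->
  brow n T' j = if j == n - r then set_nth 0 (brow n T j) c x else brow n T j.
Proof.
have := active_mem act; rewrite mem_rd_boxes (proj1 (proj1 oT)) /= => /andP[rn _].
move=> jn; rewrite /brow nth_set_entry /=.
rewrite (_ : (n - j == r) = (j == n - r)); last lia.
by case: (j =P n - r) => // ->; rewrite subKn // ltnW.
Qed.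

Lemma step_size j : size (brow n T' j) = size (brow n T j).
Proof. by rewrite /brow size_nth_set_entry ?(active_mem act). Qed.

Lemma step_row j : j = n - r -> nth [::] T r = brow n T j /\ c < size (brow n T j).
Proof.
move=> ->; have := active_mem act; rewrite mem_rd_boxes (proj1 (proj1 oT)) /=.
by case/andP => rn cs; rewrite /brow subKn // ltnW.
Qed.

Lemma step_hook_filling : hook_filling n T'.
Proof.
have [[sT pT] _] := oT; have bT := active_mem act.
have [rl _] := active_pos n1 oT act lE; have iN := low_bounds i n1.
split=> [|j jn]; first by rewrite size_set_entry.
rewrite step_brow //; have [hk bd] := pT j jn; case: eqP => [jE|//].
have [rE cs] := step_row jE; split.
  rewrite -rE; apply: hook_active act lE lx _ _; rewrite rE //.
  by apply: sub_all bd => a /andP[].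
have xb : 0 < x <= j by move: lx; rewrite /letter; lia.
apply/(all_nthP 0) => k; rewrite size_set_nth (maxn_idPr cs) nth_set_nth /= => kb.
by case: (k =P c) => // _; move/(all_nthP 0): bd => /(_ k kb).
Qed.

Lemma step_run j : 0 < j <= n -> j != (low i).+1 ->
  run j (brow n T' j) = (size (brow n T' j.-1)).+1.
Proof.
have [[sT pT] rT] := oT; have bT := active_mem act.
have [rl _] := active_pos n1 oT act lE; have iN := low_bounds i n1.
move=> jn jl; rewrite step_size -rT // step_brow //; case: eqP => // jE.
have [rE cs] := step_row jE.
apply: run_set_after => // [|_]; last by move: lx; rewrite /letter; lia.
rewrite leqNgt; apply/negP => /(@nth_run j); rewrite -rE -/(entry T (r, c)).
by move: lE; rewrite /letter entry_seg; lia.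
Qed.

Lemma step_run_low : r <> n - (low i).+1 ->
  run (low i).+1 (brow n T' (low i).+1) = (size (brow n T' (low i))).+1.
Proof.
move=> rn; have [_ rT] := oT; have iN := low_bounds i n1.
have := active_mem act; rewrite mem_rd_boxes (proj1 (proj1 oT)) /= => /andP[rN _].
rewrite step_size; have := rT (low i).+1 ltac:(lia); rewrite /= => <-.
by rewrite step_brow; last lia; case: ((low i).+1 =P n - r) => // ?; lia.
Qed.

End Step.

(** Only a box of the row starting with [(low i).+1] can meet an initial run,
    and then it is the last box of it. *)
Lemma sdt_e_runs n (i : Iq n) T T' : 1 < n -> dml_filling n T -> sdt_e i T = Some T' ->
  [/\ hook_filling n T',
      forall j, 0 < j <= n -> j != (low i).+1 ->
        run j (brow n T' j) = (size (brow n T' j.-1)).+1 &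
      run (low i).+1 (brow n T' (low i).+1) = (size (brow n T' (low i))).+1 \/
      run (low i).+1 (brow n T' (low i).+1) = size (brow n T' (low i))].
Proof.
move=> n1 oT /sdt_eP[[r c] [act bE ->]].
have lE : letter (low i) (entry T (r, c)) by rewrite /letter bE eqxx orbT.
have lx : letter (low i) (low i) by rewrite /letter eqxx.
have iN := low_bounds i n1; have [_ rT] := oT.
have jn : 0 < (low i).+1 <= n by lia.
split.
- exact: (step_hook_filling n1 oT act lE lx).
- by move=> j jn' jl; exact: (step_run n1 oT act lE lx).
case: (r =P n - (low i).+1) => [rE|rN]; last by left; exact: (step_run_low n1 oT act lE lx).
have jE : (low i).+1 = n - r by lia.
have [_ cs] := step_row oT act jE.
have [_ /(_ rE) /= [/(_ bE) h _ nx]] := active_pos n1 oT act lE.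
have rl := rT _ jn; rewrite /= in rl.
rewrite (step_brow n1 oT act lE lx) // -jE eqxx (step_size _ act) -rl.
case: h => h; [right|left]; last by apply: run_set_after => //; [exact: ltnW|lia].
apply: eq_add_S; rewrite -rl -h; congr S; apply: run_eq; rewrite ?size_set_nth; first lia.
  move=> k kc; rewrite nth_set_nth /=; case: eqP => [?|_]; first lia.
  by apply: nth_run; lia.
by rewrite nth_set_nth /= eqxx; lia.
Qed.

Lemma inf_e_spec n (i : Iq n) T T' : 1 < n -> dml_filling n T -> sdt_e i T = Some T' ->
  dml_filling n (restore_e n (low i) T') /\ same_core n (restore_e n (low i) T') T'.
Proof.
move=> n1 oT eT; have [h1 h2 h3] := sdt_e_runs n1 oT eT.
exact: restore_e_inf (low_bounds i n1) h2 h3.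
Qed.

(** Only the box behind the initial run of the row starting with [(low i).+1]
    can prolong a run, and the run stops there since the next letter would
    match the changed one if it were [(low i).+1]. *)
Lemma sdt_f_runs n (i : Iq n) T T' : 1 < n -> dml_filling n T -> sdt_f i T = Some T' ->
  [/\ hook_filling n T',
      forall j, 0 < j <= n -> j != (low i).+1 ->
        run j (brow n T' j) = (size (brow n T' j.-1)).+1 &
      run (low i).+1 (brow n T' (low i).+1) = (size (brow n T' (low i))).+1 \/
      run (low i).+1 (brow n T' (low i).+1) = (size (brow n T' (low i))).+2].
Proof.
move=> n1 oT /sdt_fP[[r c] [act bE ->]].
have lE : letter (low i) (entry T (r, c)) by rewrite /letter bE eqxx.
have lx : letter (low i) (low i).+1 by rewrite /letter eqxx orbT.
have iN := low_bounds i n1; have [_ rT] := oT.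
have jn : 0 < (low i).+1 <= n by lia.
split.
- exact: (step_hook_filling n1 oT act lE lx).
- by move=> j jn' jl; exact: (step_run n1 oT act lE lx).
case: (r =P n - (low i).+1) => [rE|rN]; last by left; exact: (step_run_low n1 oT act lE lx).
have jE : (low i).+1 = n - r by lia.
have [_ cs] := step_row oT act jE.
have [_ /(_ rE) /= [_ /(_ bE) h nx]] := active_pos n1 oT act lE.
have rl := rT _ jn; rewrite /= in rl.
rewrite (step_brow n1 oT act lE lx) // -jE eqxx (step_size _ act) -rl.
case: (ltngtP (run (low i).+1 (brow n T (low i).+1)) c) h => // h _; [left|right].
  by apply: run_set_after => //; [exact: ltnW|lia].
rewrite h; apply: run_eq; rewrite ?size_set_nth; first lia.
  move=> k kc; rewrite nth_set_nth /=; case: eqP => [//|?].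
  by apply: nth_run; lia.
by rewrite (maxn_idPr cs) nth_set_nth /= (gtn_eqF (ltnSn c)) => /nx.
Qed.

Lemma inf_f_spec n (i : Iq n) T T' : 1 < n -> dml_filling n T -> sdt_f i T = Some T' ->
  dml_filling n (restore_f n (low i) T') /\ same_core n (restore_f n (low i) T') T'.
Proof.
move=> n1 oT eT; have [h1 h2 h3] := sdt_f_runs n1 oT eT.
exact: restore_f_inf (low_bounds i n1) h2 h3.
Qed.

Lemma inf_eE n (i : Iq n) T :
  inf_e i T = omap (restore_e n (low i)) (sdt_e i T).
Proof. by case: i. Qed.

Lemma inf_fE n (i : Iq n) T :
  inf_f i T = omap (restore_f n (low i)) (sdt_f i T).
Proof. by case: i. Qed.

(** Restoring the initial runs leaves the cores alone, so an operator of SDT(-oo)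
    picks the dual marginally large tableau with the cores of the value on
    semistandard decomposition tableaux. *)
Lemma inf_eP n (i : Iq n) T U : 1 < n -> dml_filling n T ->
  inf_e i T = Some U <->
  dml_filling n U /\ exists2 T', sdt_e i T = Some T' & same_core n U T'.
Proof.
move=> n1 oT; rewrite inf_eE; case E: (sdt_e i T) => [T'|] /=; last first.
  by split=> // -[_ []].
have [h1 h2] := inf_e_spec n1 oT E; split=> [[<-]|[oU [_ [<-] cU]]].
  by split=> //; exists T'.
by congr Some; apply: dml_filling_inj h1 oU _; apply: same_core_trans h2 (same_core_sym cU).
Qed.

Lemma inf_fP n (i : Iq n) T U : 1 < n -> dml_filling n T ->
  inf_f i T = Some U <->
  dml_filling n U /\ exists2 T', sdt_f i T = Some T' & same_core n U T'.
Proof.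
move=> n1 oT; rewrite inf_fE; case E: (sdt_f i T) => [T'|] /=; last first.
  by split=> // -[_ []].
have [h1 h2] := inf_f_spec n1 oT E; split=> [[<-]|[oU [_ [<-] cU]]].
  by split=> //; exists T'.
by congr Some; apply: dml_filling_inj h1 oU _; apply: same_core_trans h2 (same_core_sym cU).
Qed.

(** * Shapes *)

Lemma coord_ord n (mu : 'rV[int]_n) (k : 'I_n) : coord mu k.+1 = mu 0%R k.
Proof. by rewrite /coord (big_pred1 k). Qed.

Lemma coord_nat n (mu : 'rV[int]_n) k : 0 < k <= n ->
  exists2 k' : 'I_n, k'.+1 = k & coord mu k = mu 0%R k'.
Proof.
move=> kn; have kl : k.-1 < n by lia.
have kE : (Ordinal kl).+1 = k by rewrite /=; lia.
by exists (Ordinal kl) => //; rewrite -{1}kE coord_ord.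
Qed.

Lemma part_shape n T k : 0 < k <= n -> part (sdt_shape n T) k = size (trow T k).
Proof.
move=> kn; have [k' kE] := coord_nat (sdt_shape n T) kn.
by rewrite /part => ->; rewrite mxE -kE; lia.
Qed.

Lemma part_le0 n (la : 'rV[int]_n) (k : 'I_n) : Lam la ->
  la 0%R k = (- (part la k.+1)%:Z)%R.
Proof. by move=> [h _]; have := h k; rewrite /part coord_ord; lia. Qed.

Lemma partD n (la mu : 'rV[int]_n) k : Lam la -> Lam mu -> 0 < k <= n ->
  part (la + mu)%R k = part la k + part mu k.
Proof.
move=> hl hm kn; have [k' kE E] := coord_nat (la + mu)%R kn.
by rewrite {1}/part E mxE (part_le0 k' hl) (part_le0 k' hm) kE; lia.
Qed.

Lemma Lam_part_le n (la : 'rV[int]_n) k : Lam la -> 0 < k < n ->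
  part la k.+1 <= part la k.
Proof. by move=> [_ h] /h[]. Qed.

Lemma LamD n (la mu : 'rV[int]_n) : Lam la -> Lam mu -> Lam (la + mu)%R.
Proof.
move=> hl hm; split=> [k|k kn].
  by rewrite mxE (part_le0 k hl) (part_le0 k hm); lia.
rewrite !partD //; try lia.
have := Lam_part_le hl kn; have := Lam_part_le hm kn.
have [_ /(_ k kn) [_ h1]] := hl; have [_ /(_ k kn) [_ h2]] := hm.
move=> le1 le2; split; first lia.
move=> E; have [|z1 z2] := h1; first lia.
by have [|z3 z4] := h2; lia.
Qed.

Lemma part_gt0_le n (la : 'rV[int]_n) j k : Lam la -> 0 < j <= k -> k <= n ->
  0 < part la k -> 0 < part la j.
Proof.
move=> hl; elim: k => [|k IH] jk kn pk; first lia.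
case: (j =P k.+1) => [->//|jk'].
have := Lam_part_le hl (k := k) ltac:(lia) => h.
by apply: IH; lia.
Qed.

(** The nonzero parts come first, so counting them finds the last one. *)
Lemma ell_part n (la : 'rV[int]_n) k : Lam la -> 0 < k <= n ->
  (k <= ell la) = (0 < part la k).
Proof.
move=> hl kn; rewrite /ell; set S := [set _ | _]%SET.
have inS (i : 'I_n) : (i \in S) = (0 < part la i.+1).
  by rewrite inE (part_le0 i hl); lia.
have winj m (mn : m <= n) : injective (widen_ord mn).
  by move=> a b /(congr1 val) /= /val_inj.
apply/idP/idP => h.
  rewrite lt0n; apply/negP => /eqP pk.
  have k1 : k.-1 <= n by lia.
  have : #|S| <= k.-1; last lia.
  rewrite -[X in _ <= X]card_ord -(card_imset _ (winj _ k1)).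
  apply: subset_leq_card; apply/fintype.subsetP => i; rewrite inS => pi.
  have ik : i < k.-1.
    rewrite ltnNge; apply/negP => ki.
    by have := @part_gt0_le n la k i.+1 hl ltac:(lia) (ltn_ord i) pi; lia.
  by apply/imsetP; exists (Ordinal ik) => //; apply: val_inj.
have : #|[set widen_ord (proj2 (andP kn)) i | i : 'I_k]%SET| <= #|S|.
  apply: subset_leq_card; apply/fintype.subsetP => _ /imsetP[i _ ->].
  by rewrite inS; apply: part_gt0_le h => //=; have := ltn_ord i; lia.
by rewrite card_imset ?card_ord //; exact: winj.
Qed.

(** * Semistandard decomposition tableaux *)

Definition shaped n (la : 'rV[int]_n) (T : filling) : Prop :=
  size T = n /\ forall k, 0 < k <= n -> size (trow T k) = part la k.

Lemma brow_trow n T j : brow n T j = trow T (n - j).+1.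
Proof. by []. Qed.

Section SDT.
Variables (n : nat) (la : 'rV[int]_n) (T : filling).
Hypotheses (hl : Lam la) (hT : is_SDT la T).

Lemma SDT_shaped : shaped la T. Proof. by case: hT. Qed.

Lemma SDT_empty k : 0 < k <= n -> ell la < k -> trow T k = [::].
Proof.
move=> kn; rewrite ltnNge ell_part // -(proj2 SDT_shaped k kn).
by case: (trow T k).
Qed.

Lemma SDT_hook k : 0 < k <= n -> trow T k <> [::] -> hook_word (trow T k).
Proof.
move=> kn ne; have [_ _ hk _] := hT; apply: hk.
rewrite ell_part // -(proj2 SDT_shaped k kn).
by case: (trow T k) ne => //=; lia.
Qed.

(** A letter of a row that is not smaller than the first entry of the row above
    would extend the latter to a longer hook subword. *)
Lemma SDT_lt_head k a : 0 < k < n -> a \in trow T k.+1 -> a < head 0 (trow T k).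
Proof.
move=> kn ak; have [_ _ hk hmax] := hT.
have k1 : k < ell la.
  by rewrite ltnNge; apply/negP => ek; move: ak; rewrite SDT_empty //; lia.
rewrite ltnNge; apply/negP => h.
have := hmax k ltac:(lia) (a :: trow T k); rewrite /= ltnn => H.
apply: notF; apply: H.
  by rewrite -cat1s; apply: cat_subseq; rewrite ?sub1seq.
by apply: hook_cons h; apply: hk; lia.
Qed.

(** By [SDT_lt_head] the bound on the letters drops by one from each row to the
    next one below, starting from n. *)
Lemma SDT_bounded : bounded n T.
Proof.
have [sT shT] := SDT_shaped; split=> // j jn.
suff H k : 0 < k <= n -> all (fun a => 0 < a <= n.+1 - k) (trow T k).
  have := H (n - j).+1 ltac:(lia); rewrite (_ : n.+1 - (n - j).+1 = j) //; lia.
have [_ let_ _ _] := hT.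
elim: k => [|k IH] kn; first lia.
case: (posnP k) => [k0|k0]; first rewrite k0; first by apply/allP => a /(let_ 1 a ltac:(lia)); lia.
apply/allP => a ak; have := let_ _ a kn ak.
have := @SDT_lt_head k a ltac:(lia) ak; have := IH ltac:(lia).
by case: (trow T k) => //= b u /andP[]; lia.
Qed.

(** The letters [i] of the lower row, followed by the upper row without its
    initial run, form a hook subword; it is not longer than the upper row. *)
Lemma SDT_low_matched i : 0 < i < n -> low_matched n i T.
Proof.
move=> ln; split; first exact: SDT_bounded.
have [_ _ hk hmax] := hT; have [_ bd] := SDT_bounded.
have bdi := bd i.+1 ltac:(lia).
case: (leqP (n - i).+1 (ell la)) => [le_ell|lt_ell]; last first.
  by rewrite brow_trow ?SDT_empty //; lia.
case: (posnP (count_mem i (brow n T i))) => [->//|c0].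
have E : brow n T i.+1 = trow T (n - i) by rewrite /trow /brow; congr (nth _ _ _); lia.
have := run_le i.+1 (brow n T i.+1); rewrite E in bdi *.
set c := count_mem _ _ in c0 *; set v := trow T (n - i) in bdi *.
set d := run _ _ => dv.
have := hmax (n - i) ltac:(lia) (nseq c i ++ drop d v).
rewrite size_cat size_nseq size_drop => H.
suff : c + (size v - d) <= size v by lia.
apply: H; first apply: cat_subseq; last 2 first.
- exact: drop_subseq.
- apply: hook_nseq_cat => //.
  case: (leqP (size v) d) => dn; first by left; apply: drop_oversize.
  right; split; first by apply: hook_drop => //; apply: hk; lia.
  have := nth_run_stop dn; move/(all_nthP 0): bdi => /(_ d dn).
  by rewrite -nth0 nth_drop addn0 -/d; lia.
rewrite -/(brow n T i) (_ : nseq c i = [seq a <- brow n T i | a == i]) ?filter_subseq //.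
by rewrite /c -size_filter; symmetry; apply/all_pred1P; exact: filter_all.
Qed.

(** Semistandardness enters the theory of the operators only through this. *)
Lemma SDT_extensible (i : Iq n) : 1 < n -> extensible i T.
Proof.
move=> n1; case: i => [[j jn]|]; first exact: SDT_low_matched.
split; first exact: SDT_bounded.
have [sT shT] := SDT_shaped; rewrite !brow_trow !shT; try lia.
rewrite (_ : (n - 1).+1 = (n - 2).+2); last lia.
by have := Lam_part_le hl (k := (n - 2).+1) ltac:(lia); lia.
Qed.

Lemma SDT_hook_brow j : 0 < j <= n -> brow n T j <> [::] -> hook_word (brow n T j).
Proof. by move=> jn; rewrite -[brow n T j]/(trow T (n - j).+1) => ne; apply: SDT_hook => //; lia. Qed.

End SDT.

Lemma subseq_cat_inv (w u v : seq nat) : subseq w (u ++ v) ->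
  exists w1 w2 : seq nat, [/\ w = w1 ++ w2, subseq w1 u & subseq w2 v].
Proof.
elim: u w => [|a u IH] w /=; first by move=> h; exists [::], w.
case: w => [|b w]; first by exists [::], [::]; rewrite !sub0seq.
case: eqP => [->|ba] /IH[w1 [w2 [E h1 h2]]].
  by exists (a :: w1), w2; split=> //=; rewrite ?E ?eqxx.
exists w1, w2; split=> //; case: w1 E h1 => // c w1 _ h1.
exact: subseq_trans h1 (subseq_cons u a).
Qed.

(** A hook subword that meets the lower row [u] ascends when it comes to the
    initial run of the upper row [v]; so it uses the run at most once, and then
    nothing behind it. *)
Lemma large_run_hook x (u v w : seq nat) :
  all (fun a => a < x) u -> all (fun a => a <= x) v -> size u < run x v ->
  subseq w (u ++ v) -> hook_word w -> size w <= size v.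
Proof.
move=> ux vx uv /subseq_cat_inv[w1 [w2 [-> s1 s2]]] hk.
have rv := run_le x v; have sz1 : size w1 <= size u by exact: size_subseq.
rewrite size_cat.
move: s2; rewrite {1}(run_cat_drop x v) => /subseq_cat_inv[p [q [wE s3 s4]]].
have szq : size q <= size v - run x v by rewrite -size_drop; exact: size_subseq.
case: (posnP (size w1)) => [w10|w1p].
  by rewrite w10; apply: size_subseq; rewrite wE [X in subseq _ X](run_cat_drop x v) cat_subseq.
case: p s3 wE => [|y p] s3 wE; first by rewrite wE /=; lia.
have yx z : z \in y :: p -> z = x by move=> /(mem_subseq s3); rewrite mem_nseq => /andP[_ /eqP].
suff : size w2 <= 1 by lia.
rewrite leqNgt; apply/negP => w2s; move/hook_wordP: hk => [_ /(_ (size w1).-1)].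
have w1E : (size w1).-1.+1 = size w1 by lia.
have n1 : nth 0 (w1 ++ w2) (size w1).-1 < x.
  rewrite nth_cat (_ : (size w1).-1 < size w1); last lia.
  by apply: (allP ux); apply: (mem_subseq s1); apply: mem_nth; rewrite ltn_predL.
have n2 : nth 0 (w1 ++ w2) (size w1) = x.
  by rewrite nth_cat ltnn subnn wE /= (yx y) ?mem_head.
have n3 : nth 0 (w1 ++ w2) (size w1).+1 <= x.
  rewrite nth_cat ltnNge leqnSn /= subSnn; have : nth 0 w2 1 \in w2 by exact: mem_nth.
  rewrite {2}wE mem_cat => /orP[/yx ->//|/(mem_subseq s4)/mem_drop].
  exact: (allP vx).
rewrite w1E n2 size_cat => H; have := H ltac:(lia) n1; lia.
Qed.

Lemma dml_filling_rows n T k : dml_filling n T -> 0 < k < n ->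
  size (trow T k.+1) < run (n.+1 - k) (trow T k).
Proof.
move=> [_ rT] kn; have := rT (n.+1 - k) ltac:(lia).
rewrite -[trow T k.+1]/(nth [::] T k) -[trow T k]/(nth [::] T k.-1) /brow.
rewrite (_ : n - (n.+1 - k) = k.-1); last lia.
by rewrite (_ : n - (n.+1 - k).-1 = k) => [->|]; lia.
Qed.

Lemma dml_filling_Lam n T : dml_filling n T -> Lam (sdt_shape n T).
Proof.
move=> oT; split=> [k|k kn]; first by rewrite mxE; lia.
rewrite !part_shape; try lia.
by have := dml_filling_rows oT kn; have := run_le (n.+1 - k) (trow T k); split; lia.
Qed.

Lemma dml_filling_SDT n T : dml_filling n T -> is_SDT (sdt_shape n T) T.
Proof.
move=> oT; have [[sT pT] _] := oT; have hl := dml_filling_Lam oT.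
have rE k : 0 < k <= n -> trow T k = brow n T (n.+1 - k).
  by move=> kn; rewrite /trow /brow; congr nth; lia.
have ellE : ell (sdt_shape n T) <= n.
  by rewrite /ell -[X in _ <= X]card_ord; exact: max_card.
split.
- by split=> // k kn; rewrite part_shape.
- move=> k a kn; rewrite rE // => ak.
  by have [_ /allP /(_ a ak)] := pT (n.+1 - k) ltac:(lia); lia.
- by move=> k kn; rewrite rE; last lia; apply: (proj1 (pT _ _)); lia.
- move=> k kn w sw hw.
  apply: (large_run_hook (x := n.+1 - k)) sw hw; last by apply: dml_filling_rows oT _; lia.
    rewrite rE; last lia; have [_ bd] := pT (n.+1 - k.+1) ltac:(lia).
    by apply: sub_all bd => a; lia.
  rewrite rE; last lia; have [_ bd] := pT (n.+1 - k) ltac:(lia).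
  by apply: sub_all bd => a; lia.
Qed.

Lemma SDT_infP n T : elts (SDT_inf n) T <-> dml_filling n T.
Proof.
split=> [[[la hl hT] dT]|oT].
  have [sT _] := SDT_shaped hT; have rT := elimT (dmlP sT) dT.
  split=> //; split=> // j jn; split; last first.
    by have [_ bd] := SDT_bounded hl hT; exact: bd.
  apply: (SDT_hook_brow hl hT) => // jE; have := rT j jn.
  by rewrite jE /run.
split; first by exists (sdt_shape n T); [exact: dml_filling_Lam|exact: dml_filling_SDT].
by have [[sT _] rT] := oT; apply/(dmlP sT).
Qed.

(** * Raising and lowering operators together *)

(** e for [s = true] and f for [s = false]. *)
Definition sdt_op n (s : bool) (i : Iq n) : filling -> option filling :=
  if s then sdt_e i else sdt_f i.

Definition inf_op n (s : bool) (i : Iq n) : filling -> option filling :=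
  if s then inf_e i else inf_f i.

(** The letter that the operator changes; it becomes [source (~~ s) i]. *)
Definition source n (s : bool) (i : Iq n) : nat := if s then (low i).+1 else low i.

Lemma sourceP n s (i : Iq n) : letter (low i) (source s i).
Proof. by case: s; rewrite /letter eqxx ?orbT. Qed.

Lemma sdt_opP n s (i : Iq n) T T' : sdt_op s i T = Some T' <->
  exists b, [/\ active i T b, entry T b = source s i &
    T' = set_entry T b (source (~~ s) i)].
Proof. by case: s; [exact: sdt_eP|exact: sdt_fP]. Qed.

Lemma sdt_op_inv n s (i : Iq n) T T' : sdt_op s i T = Some T' -> sdt_op (~~ s) i T' = Some T.
Proof. by case: s => /sdt_feP. Qed.

(** An operator may be applied before or after a change of the initial runs. *)
Lemma sdt_op_core_ex n s (i : Iq n) T U T' : 1 < n -> extensible i T -> strictly_extensible i U ->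
  same_core n T U -> sdt_op s i T = Some T' ->
  exists2 U', sdt_op s i U = Some U' & same_core n T' U'.
Proof. by case: s; [exact: sdt_e_core_ex|exact: sdt_f_core_ex]. Qed.

Lemma inf_opP n s (i : Iq n) T U : 1 < n -> dml_filling n T ->
  inf_op s i T = Some U <->
  dml_filling n U /\ exists2 T', sdt_op s i T = Some T' & same_core n U T'.
Proof. by case: s; [exact: inf_eP|exact: inf_fP]. Qed.

Lemma inf_op_some n s (i : Iq n) T T' : 1 < n -> dml_filling n T -> sdt_op s i T = Some T' ->
  exists2 U, inf_op s i T = Some U & dml_filling n U /\ same_core n U T'.
Proof.
case: s => n1 oT eT.
  exists (restore_e n (low i) T'); first by rewrite /inf_op inf_eE -[sdt_e i T]/(sdt_op true i T) eT.
  exact: inf_e_spec eT.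
exists (restore_f n (low i) T'); first by rewrite /inf_op inf_fE -[sdt_f i T]/(sdt_op false i T) eT.
exact: inf_f_spec eT.
Qed.

Lemma sdt_op_runs n s (i : Iq n) T T' : 1 < n -> dml_filling n T -> sdt_op s i T = Some T' ->
  [/\ bounded n T', forall j, 0 < j < n -> size (brow n T' j) <= run j.+1 (brow n T' j.+1) &
    forall j, 0 < j < n -> j != low i -> size (brow n T' j) < run j.+1 (brow n T' j.+1)].
Proof.
move=> n1 oT eT.
have [pT r1 r2] : [/\ hook_filling n T',
      forall j, 0 < j <= n -> j != (low i).+1 ->
        run j (brow n T' j) = (size (brow n T' j.-1)).+1 &
      size (brow n T' (low i)) <= run (low i).+1 (brow n T' (low i).+1)].
  by case: s eT => eT; [have [h1 h2 h3] := sdt_e_runs n1 oT eT|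
    have [h1 h2 h3] := sdt_f_runs n1 oT eT]; split=> //; lia.
have lt j : 0 < j < n -> j != low i -> size (brow n T' j) < run j.+1 (brow n T' j.+1).
  by move=> jn jl; rewrite r1 //; lia.
split=> // [|j jn]; first exact: hook_filling_bounded.
by case: (j =P low i) => [->//|/eqP jl]; apply/ltnW/lt.
Qed.

Lemma sdt_op_extensible n s (i i' :
  Iq n) T T' : 1 < n -> dml_filling n T -> sdt_op s i T = Some T' ->
  extensible i' T'.
Proof.
move=> n1 oT eT; have [bT le _] := sdt_op_runs n1 oT eT.
case: i' => [[j jn]|]; split=> //.
  exact: leq_trans (count_size _ _) (le j jn).
by have := le 1 n1; have := run_le 2 (brow n T' 2); lia.
Qed.

Lemma sdt_op_strictly_extensible n s (i i' :
  Iq n) T T' : 1 < n -> dml_filling n T -> sdt_op s i T = Some T' ->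
  low i' != low i -> strictly_extensible i' T'.
Proof.
move=> n1 oT eT il; have [bT le lt] := sdt_op_runs n1 oT eT.
case: i' il => [[j jn]|] il; split=> //.
  exact: leq_ltn_trans (count_size _ _) (lt j jn il).
by have := lt 1 n1 il; have := run_le 2 (brow n T' 2); lia.
Qed.

(** By [sdt_op_core_ex] the change can be undone after the runs are restored. *)
Lemma inf_op_inv n s (i : Iq n) T U : 1 < n -> dml_filling n T -> inf_op s i T = Some U ->
  inf_op (~~ s) i U = Some T.
Proof.
move=> n1 oT /(inf_opP _ _ _ n1 oT) [oU [T' eT cU]].
have [S eU cS] := sdt_op_core_ex n1 (sdt_op_extensible i n1 oT eT) (dml_strictly_extensible i n1 oU)
  (same_core_sym cU) (sdt_op_inv eT).
by apply/(inf_opP _ _ _ n1 oU); split=> //; exists S.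
Qed.

(** * Commutation *)

Lemma reduced_other T c x l s : ~~ letter l (entry T c) -> ~~ letter l x ->
  reduced (entry (set_entry T c x)) l s = reduced (entry T) l s.
Proof.
move=> lc lx.
have filtE : [seq b <- s | letter l (entry (set_entry T c x) b)] =
             [seq b <- s | letter l (entry T b)].
  apply: eq_filter => b; rewrite entry_set; case: (b =P c) => [->|//].
  by rewrite (negPf lc) (negPf lx).
rewrite -reduced_filter filtE -[RHS]reduced_filter; apply: eq_reduced => b.
rewrite mem_filter entry_set; case: (b =P c) => [->|//].
by rewrite (negPf lc).
Qed.

Lemma active_other n (i : Iq n) T c x b : c \in rd_boxes T ->
  ~~ letter (low i) (entry T c) -> ~~ letter (low i) x ->
  active i T b -> active i (set_entry T c x) b.
Proof.
move=> cT lc lx; case: i lc lx => [j|] lc lx /=; last first.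
  move=> <-; congr ohead; rewrite /rd_i rd_boxes_set //; apply: eq_filter => d.
  rewrite entry_set -!/(letter 1 _); case: (d =P c) => [->|//].
  by rewrite (negPf lc) (negPf lx).
move=> [s1 [s2 [E h1 h2]]]; exists s1, s2; rewrite rd_boxes_set // !reduced_other //.
split=> //; apply/allP => d ds; rewrite /is_low /is_high entry_set; case: (d =P c) => [dc|_].
- by move: (allP h1 _ ds) lc; rewrite /is_low /letter dc /= => ->.
- exact: (allP h1).
- by move: (allP h2 _ ds) lc; rewrite /is_high /letter dc /= => ->; rewrite orbT.
- exact: (allP h2).
Qed.

Definition apart n (i i' : Iq n) : Prop := (low i).+1 < low i' \/ (low i').+1 < low i.

Lemma apart_letter n (i i' : Iq n) a : apart i i' -> letter (low i) a -> ~~ letter (low i') a.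
Proof. by rewrite /apart /letter; lia. Qed.

Lemma apart_sym n (i i' : Iq n) : apart i i' -> apart i' i.
Proof. by rewrite /apart; lia. Qed.

Lemma sdt_op_comm n s s' (i i' : Iq n) T T1 V : apart i i' ->
  sdt_op s i T = Some T1 -> sdt_op s' i' T1 = Some V ->
  exists2 T2, sdt_op s' i' T = Some T2 & sdt_op s i T2 = Some V.
Proof.
move=> ap /sdt_opP[b [act bE ->]] /sdt_opP[b' [act' bE' ->]].
have ap' := apart_sym ap; have bT := active_mem act.
have lS := sourceP s i; have lN := sourceP (~~ s) i.
have lS' := sourceP s' i'; have lN' := sourceP (~~ s') i'.
have bT' : b' \in rd_boxes T by rewrite -(rd_boxes_set (source (~~ s) i) bT) (active_mem act').
have nb : b' != b.
  apply/eqP => E; move: bE'; rewrite E entry_set eqxx => E'.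
  by have := apart_letter ap lN; rewrite E' lS'.
have bE2 : entry T b' = source s' i' by rewrite -bE' entry_set (negPf nb).
exists (set_entry T b' (source (~~ s') i')); apply/sdt_opP.
  exists b'; split=> //.
  rewrite -(set_entryK (source (~~ s) i) bT); apply: active_other act'.
  - by rewrite rd_boxes_set.
  - by rewrite entry_set eqxx; apply: apart_letter ap _.
  - by rewrite bE; apply: apart_letter ap _.
exists b; split; last by rewrite set_entryC // eq_sym.
  apply: active_other act => //; last exact: apart_letter ap' _.
  by rewrite bE2; apply: apart_letter ap' _.
by rewrite entry_set eq_sym (negPf nb).
Qed.

(** Both sides have the same cores, because the operators on semistandard
    decomposition tableaux commute: they change different boxes and do not see
    each other's letters. *)
Lemma inf_op_comm n s s' (i i' : Iq n) T : 1 < n -> dml_filling n T -> apart i i' ->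
  obind (inf_op s' i') (inf_op s i T) = obind (inf_op s i) (inf_op s' i' T).
Proof.
move=> n1 oT.
suff H (i1 i2 : Iq n) s1 s2 V : apart i1 i2 ->
    obind (inf_op s2 i2) (inf_op s1 i1 T) = Some V ->
    obind (inf_op s1 i1) (inf_op s2 i2 T) = Some V.
  move=> ap; case E: (obind (inf_op s' i') _) => [V|]; first by rewrite (H _ _ _ _ _ ap E).
  case F: (obind _ _) => [V|] //; rewrite -E.
  by rewrite (H _ _ _ _ _ (apart_sym ap) F).
move=> ap; case E: (inf_op s1 i1 T) => [U|] //= eU.
have [oU [T1 eT1 cU]] := proj1 (inf_opP _ _ _ n1 oT) E.
have [oV [U1 eU1 cV]] := proj1 (inf_opP _ _ _ n1 oU) eU.
have nl : low i2 != low i1 by move: ap; rewrite /apart; lia.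
have [T2 eT2 c2] := sdt_op_core_ex n1 (strictly_extensibleW (dml_strictly_extensible i2 n1 oU))
  (sdt_op_strictly_extensible n1 oT eT1 nl) cU eU1.
have [T1' eT1' eT2'] := sdt_op_comm ap eT1 eT2.
have [U' eU' [oU' cU']] := inf_op_some n1 oT eT1'.
have [W eW cW] := sdt_op_core_ex n1 (sdt_op_extensible i1 n1 oT eT1') (dml_strictly_extensible i1 n1 oU')
  (same_core_sym cU') eT2'.
rewrite eU' /=; apply/(inf_opP _ _ _ n1 oU'); split=> //; exists W => //.
exact: same_core_trans cV (same_core_trans c2 cW).
Qed.

(** * Weights *)

(** The coordinate of the weight in SDT(lambda) (x) T_{-lambda}: the part of
    lambda that is subtracted is the length of the row [j].  A box added to this
    row contains the letter [j], so it does not affect the difference. *)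
Definition excess n (T : filling) (j : nat) : int :=
  ((count_mem j (rd T))%:Z - (size (brow n T j))%:Z)%R.

Definition neps i (T : filling) : nat := count (fun b => entry T b == i.+1) (rdbar_i i T).
Definition nphi i (T : filling) : nat := count (fun b => entry T b == i) (rdbar_i i T).

Lemma count_rd T (j : nat) : count_mem j (rd T) = \sum_(r < size T) count_mem j (nth [::] T r).
Proof.
rewrite /rd count_map -[rd_boxes T]/(flatten (map (row_boxes T) (iota 0 (size T)))).
rewrite count_flatten sumnE !big_map.
have -> : iota 0 (size T) = index_iota 0 (size T) by rewrite /index_iota subn0.
rewrite big_mkord; apply: eq_bigr => r _.
rewrite -[in RHS](mkseq_nth 0 (nth [::] T r)) count_map /row_boxes /seg count_map count_rev.
by apply: eq_count.
Qed.

Lemma count_rd_add n m T (j : nat) : size T = n -> 0 < j <= n ->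
  count_mem j (rd (add_left n m T)) = count_mem j (rd T) + m (n - j).+1.
Proof.
move=> sT jn; rewrite !count_rd size_add_left sT.
have jl : n - j < n by lia.
rewrite (eq_bigr (fun r : 'I_n => count_mem j (nth [::] T r) + (n - r == j) * m r.+1)).
  rewrite big_split /=; congr (_ + _); rewrite (bigD1 (Ordinal jl)) //= big1.
    by rewrite (_ : n - (n - j) == j) ?mul1n ?addn0 //; lia.
  move=> r rj; rewrite (_ : (n - r == j) = false) //; apply/negP => /eqP rE.
  by move/eqP: rj; apply; apply: val_inj => /=; have := ltn_ord r; lia.
by move=> r _; rewrite nth_add_left // count_cat count_nseq addnC.
Qed.

Lemma count_rd_set T (b : box) (x j : nat) : b \in rd_boxes T ->
  count_mem j (rd (set_entry T b x)) + (entry T b == j) = count_mem j (rd T) + (x == j).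
Proof.
move=> bT; rewrite /rd rd_boxes_set // !count_map.
have := uniq_rd_boxes T; case/splitPr: bT => s1 s2.
rewrite cat_uniq /= => /and3P[_ /norP[b1 _] /andP[b2 _]].
rewrite !count_cat /= entry_set eqxx.
have E s : b \notin s -> count (preim (entry (set_entry T b x)) (pred1 j)) s =
    count (preim (entry T) (pred1 j)) s.
  move=> bs; apply: eq_in_count => c cs /=; rewrite entry_set.
  by case: (c =P b) => // cb; rewrite -cb cs in bs.
by rewrite !E // -!addnA; congr (_ + _); rewrite [LHS]addnC [RHS]addnCA addnA.
Qed.

Lemma excess_core n T U j : size T = n -> size U = n -> same_core n T U -> 0 < j <= n ->
  excess n T j = excess n U j.
Proof.
move=> sT sU /same_core_ext[m [m' [E _ _]]] jn.
have := congr1 (fun V => count_mem j (rd V)) E.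
have := congr1 (fun V => size (brow n V j)) E.
rewrite !brow_add_left // !size_cat !size_nseq !count_rd_add // /excess; lia.
Qed.

Lemma nsig_add n i m T : 0 < i < n -> low_matched n i T -> mono n m ->
  neps i (add_left n m T) = neps i T + (m (n - i) - m (n - i).+1) /\
  nphi i (add_left n m T) = nphi i T.
Proof.
move=> iN gT hm; rewrite /neps /nphi -!size_filter !filter_rdbar_add // eqxx.
rewrite (_ : (i == i.+1) = false); last lia.
by rewrite !size_cat size_seg !size_map addn0.
Qed.

(** The unmatched letters that added boxes contribute to the signature are as
    many as the difference of the lengths of the two rows grows by. *)
Lemma nsig_core n i T U : 0 < i < n -> low_matched n i T -> low_matched n i U -> same_core n T U ->
  nphi i T = nphi i U /\
  neps i T + size (brow n T i) + size (brow n U i.+1) =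
  neps i U + size (brow n U i) + size (brow n T i.+1).
Proof.
move=> iN gT gU /same_core_ext[m [m' [E mT mU]]].
have [e1 p1] := nsig_add iN gT mT; have [e2 p2] := nsig_add iN gU mU.
have := mT i iN; have := mU i iN.
have := congr1 (fun V => size (brow n V i)) E.
have := congr1 (fun V => size (brow n V i.+1)) E.
rewrite !brow_add_left; try lia.
rewrite !size_cat !size_nseq (_ : (n - i.+1).+1 = n - i); last lia.
by move: e1 p1 e2 p2; rewrite E => -> -> ? ?; lia.
Qed.

Lemma nsig_set i T b x : signature_box i T b -> letter i (entry T b) -> letter i x ->
  neps i (set_entry T b x) + (entry T b == i.+1) = neps i T + (x == i.+1) /\
  nphi i (set_entry T b x) + (entry T b == i) = nphi i T + (x == i).
Proof.
move=> [s1 [s2 [E h1 h2]]] lb lx; set T' := set_entry T b x.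
have bT : b \in rd_boxes T by rewrite E mem_cat mem_head orbT.
have := uniq_rd_boxes T; rewrite E cat_uniq /= => /and3P[_ /norP[b1 _] /andP[b2 _]].
have eqE (s : seq box) : b \notin s -> {in s, entry T' =1 entry T}.
  by move=> bs c cs; rewrite entry_set; case: (c =P b) => // cb; rewrite -cb cs in bs.
have rE (s : seq box) : b \notin s -> reduced (entry T') i s = reduced (entry T) i s.
  by move=> bs; apply: eq_reduced; exact: eqE.
have cE (s : seq box) (a : nat) : b \notin s -> count (fun c => entry T' c == a) (reduced (entry T) i s) =
    count (fun c => entry T c == a) (reduced (entry T) i s).
  by move=> bs; apply: eq_in_count => c /reduced_mem cs; rewrite (eqE s).
have a1 : all (is_low (entry T') i) (reduced (entry T) i s1).
  by apply/allP => c cs; rewrite /is_low (eqE s1) ?(reduced_mem cs) //; exact: (allP h1).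
have a2 : all (is_high (entry T') i) (reduced (entry T) i s2).
  by apply/allP => c cs; rewrite /is_high (eqE s2) ?(reduced_mem cs) //; exact: (allP h2).
rewrite /neps /nphi !rdbar_reduced rd_boxes_set // E.
rewrite !reduced_join ?rE // ?[_ || _]lb //; last by rewrite /is_low /is_high entry_set eqxx.
by rewrite !count_cat /= !cE // entry_set eqxx; lia.
Qed.

(** A cancelled pair has one letter of each kind. *)
Lemma nsig_diff i T :
  nphi i T + count_mem i.+1 (rd T) = neps i T + count_mem i (rd T).
Proof.
rewrite /nphi /neps rdbar_reduced /rd !count_map.
elim: (rd_boxes T) => //= b s IH; rewrite reduced_cons /is_low /is_high /sig_step.
case: (reduced _ i s) IH => [|c w] /=; case: ifP => /=; try case: ifP => /=; lia.
Qed.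

(** * The functions on the twisted crystals *)

Lemma part_brow n (la : 'rV[int]_n) T j : shaped la T -> 0 < j <= n ->
  part la (n - j).+1 = size (brow n T j).
Proof. by move=> [_ h] jn; rewrite -h //; lia. Qed.

Lemma twist_wt n (la : 'rV[int]_n) T k : shaped la T ->
  wt (SDT_twist la) (T, tt) 0%R k = excess n T k.+1.
Proof.
move=> sh; rewrite /= !mxE /excess -(part_brow sh); last by have := ltn_ord k; lia.
by rewrite (_ : (n - k.+1).+1 = n - k) //; have := ltn_ord k; lia.
Qed.

Lemma w0_wti n (la : 'rV[int]_n) T (i : I0 n) : shaped la T ->
  wti (B := Tcrystal (- w0 la)%R) i tt =
  ((size (brow n T i.+1))%:Z - (size (brow n T i))%:Z)%R.
Proof.
move=> sh; have /andP[i0 iN] := idx_bounds i; rewrite /wti /=.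
have cE j : 0 < j <= n -> coord (- w0 la)%R j = (- (size (brow n T j))%:Z)%R.
  move=> jn; have [k kE ->] := coord_nat (- w0 la)%R jn.
  by rewrite !mxE -(part_brow sh jn) -kE; congr (- (part la _)%:Z)%R; have := ltn_ord k; lia.
by rewrite !cE; lia.
Qed.

Lemma twist_eps n (la : 'rV[int]_n) T (i : I0 n) : shaped la T ->
  eps (SDT_twist la) i (T, tt) =
  Some ((neps i T)%:Z + (size (brow n T i))%:Z - (size (brow n T i.+1))%:Z)%R.
Proof.
by move=> sh; rewrite /= (w0_wti i sh) /neps; congr Some; lia.
Qed.

Lemma twist_phi n (la : 'rV[int]_n) T (i : I0 n) :
  phi (SDT_twist la) i (T, tt) = Some (nphi i T)%:Z%R.
Proof. by []. Qed.

(** Hence weights and signatures of the twisted crystals induce functions on the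
    direct limit. *)
Lemma twist_core n (la mu : 'rV[int]_n) T U : shaped la T -> shaped mu U ->
  same_core n T U ->
  wt (SDT_twist la) (T, tt) = wt (SDT_twist mu) (U, tt) /\
  forall i : I0 n, extensible (Some i) T -> extensible (Some i) U ->
    eps (SDT_twist la) i (T, tt) = eps (SDT_twist mu) i (U, tt) /\
    phi (SDT_twist la) i (T, tt) = phi (SDT_twist mu) i (U, tt).
Proof.
move=> shT shU h; split=> [|i gT gU].
  apply/rowP => k; rewrite !twist_wt //.
  by apply: excess_core h _; [case: shT|case: shU|have := ltn_ord k; lia].
rewrite !twist_eps // !twist_phi.
have [-> e] := nsig_core (idx_bounds i) gT gU h; split=> //; congr Some; lia.
Qed.

(** * SDT(-oo) is a crystal *)

Lemma shaped_shape n T : size T = n -> shaped (sdt_shape n T) T.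
Proof. by move=> sT; split=> // k kn; rewrite part_shape. Qed.

Lemma wt_inf n T k : size T = n -> wt (SDT_inf n) T 0%R k = excess n T k.+1.
Proof. by move=> sT; exact: twist_wt (shaped_shape sT). Qed.

Lemma eps_inf n T (i : I0 n) : size T = n -> eps (SDT_inf n) i T =
  Some ((neps i T)%:Z + (size (brow n T i))%:Z - (size (brow n T i.+1))%:Z)%R.
Proof. by move=> sT; exact: twist_eps (shaped_shape sT). Qed.

Lemma phi_inf n T (i : I0 n) : phi (SDT_inf n) i T = Some (nphi i T)%:Z%R.
Proof. by []. Qed.

Lemma sdt_op_shape n s (i : Iq n) T T' : sdt_op s i T = Some T' ->
  size T' = size T /\ forall r, size (nth [::] T' r) = size (nth [::] T r).
Proof.
move=> /sdt_opP[b [act _ ->]]; have bT := active_mem act.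
by split=> [|r]; [rewrite size_set_entry|rewrite size_nth_set_entry].
Qed.

Lemma inf_op_twist n s (i : Iq n) T U : 1 < n -> dml_filling n T -> inf_op s i T = Some U ->
  dml_filling n U /\ exists T', [/\ sdt_op s i T = Some T',
    wt (SDT_inf n) U = wt (SDT_inf n) T' &
    forall i' : I0 n, eps (SDT_inf n) i' U = eps (SDT_inf n) i' T' /\
                      phi (SDT_inf n) i' U = phi (SDT_inf n) i' T'].
Proof.
move=> n1 oT /(inf_opP _ _ _ n1 oT)[oU [T' eT cU]]; split=> //; exists T'.
have [[sT _] _] := oT; have [[sU _] _] := oU.
have sT' : size T' = n by rewrite (proj1 (sdt_op_shape eT)).
have [h1 h2] := twist_core (shaped_shape sU) (shaped_shape sT') cU.
split=> // i'; apply: h2; last exact: sdt_op_extensible eT.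
exact: strictly_extensibleW (dml_strictly_extensible _ n1 oU).
Qed.

Definition raise_sign (s : bool) : int := if s then 1%R else (-1)%R.

Lemma inf_op_wt n s (i : Iq n) T U : 1 < n -> dml_filling n T -> inf_op s i T = Some U ->
  wt (SDT_inf n) U = (wt (SDT_inf n) T + alpha n (low i) *~ raise_sign s)%R.
Proof.
move=> n1 oT /(inf_op_twist n1 oT)[_ [T' [eT -> _]]].
have [[sT _] _] := oT; have [sT' shT'] := sdt_op_shape eT; rewrite sT in sT'.
have iN := low_bounds i n1.
apply/rowP => k; rewrite [RHS]mxE !wt_inf //.
have kn := ltn_ord k.
move/sdt_opP: eT => [b [act bE T'E]]; have bT := active_mem act.
have := count_rd_set (source (~~ s) i) k.+1 bT.
rewrite -T'E bE /excess {2}/brow shT' -/(brow n T k.+1) /raise_sign /source /alpha.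
by case: s {bE T'E} => /=; rewrite ?mulrN1z ?mulr1z !mxE; lia.
Qed.

Lemma inf_op_eps n s (i : I0 n) T U : 1 < n -> dml_filling n T ->
  inf_op s (Some i) T = Some U ->
  eps (SDT_inf n) i U = zadd (eps (SDT_inf n) i T) (- raise_sign s)%R /\
  phi (SDT_inf n) i U = zadd (phi (SDT_inf n) i T) (raise_sign s).
Proof.
move=> n1 oT /(inf_op_twist n1 oT)[_ [T' [eT _ /(_ i)[-> ->]]]].
have [[sT _] _] := oT; have [sT' shT'] := sdt_op_shape eT; rewrite sT in sT'.
rewrite !eps_inf // !phi_inf /= /brow !shT'.
move/sdt_opP: eT => [b [act bE ->]].
have lE := sourceP s (Some i); have lx := sourceP (~~ s) (Some i).
have := nsig_set act (b := b) (x := source (~~ s) (Some i)).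
rewrite bE => /(_ lE lx) [e p].
by split; congr Some; move: e p; rewrite /raise_sign /source; case: s {bE lE lx} => /=; lia.
Qed.

Lemma inf_op_eps_apart n s (i : Iq n) (i' : I0 n) T U : 1 < n -> dml_filling n T ->
  apart i (Some i') -> inf_op s i T = Some U ->
  eps (SDT_inf n) i' U = eps (SDT_inf n) i' T /\
  phi (SDT_inf n) i' U = phi (SDT_inf n) i' T.
Proof.
move=> n1 oT ap /(inf_op_twist n1 oT)[_ [T' [eT _ /(_ i')[-> ->]]]].
have [[sT _] _] := oT; have [sT' shT'] := sdt_op_shape eT; rewrite sT in sT'.
rewrite !eps_inf // !phi_inf /brow !shT'.
move/sdt_opP: eT => [b [act bE ->]]; have bT := active_mem act.
have lb : ~~ letter i' (entry T b).
  by rewrite bE; apply: (apart_letter ap) (sourceP s i).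
have lx : ~~ letter i' (source (~~ s) i).
  exact: (apart_letter ap) (sourceP (~~ s) i).
have rE : rdbar_i i' (set_entry T b (source (~~ s) i)) = rdbar_i i' T.
  by rewrite !rdbar_reduced rd_boxes_set // reduced_other.
have cE a : letter i' a ->
    count (fun c => entry (set_entry T b (source (~~ s) i)) c == a) (rdbar_i i' T) =
    count (fun c => entry T c == a) (rdbar_i i' T).
  move=> la; apply: eq_in_count => c _; rewrite entry_set; case: (c =P b) => // ->.
  have -> : (source (~~ s) i == a) = false by apply/negP => /eqP E; rewrite E la in lx.
  by symmetry; apply/negP => /eqP E; rewrite E la in lb.
rewrite /neps /nphi rE !cE // /letter ?eqxx ?orbT //.
Qed.

Lemma coord_wt_inf n T j : dml_filling n T -> 0 < j <= n ->
  coord (wt (SDT_inf n) T) j = excess n T j.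
Proof.
move=> [[sT _] _] jn; have [k kE ->] := coord_nat (wt (SDT_inf n) T) jn.
by rewrite wt_inf // kE.
Qed.

Lemma SDT_inf_crystal n : 1 < n -> is_q_crystal (SDT_inf n).
Proof.
move=> n1.
have cl s (i : Iq n) b b' : elts (SDT_inf n) b -> inf_op s i b = Some b' ->
    elts (SDT_inf n) b'.
  by move=> /SDT_infP oT /(inf_op_twist n1 oT)[oU _]; apply/SDT_infP.
have wtE (i : Iq n) b b' : elts (SDT_inf n) b -> inf_e i b = Some b' ->
    wt (SDT_inf n) b' = (wt (SDT_inf n) b + alpha n (low i))%R.
  by move=> /SDT_infP oT /(@inf_op_wt n true i _ _ n1 oT); rewrite mulr1z.
have wtF (i : Iq n) b b' : elts (SDT_inf n) b -> inf_f i b = Some b' ->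
    wt (SDT_inf n) b' = (wt (SDT_inf n) b - alpha n (low i))%R.
  by move=> /SDT_infP oT /(@inf_op_wt n false i _ _ n1 oT); rewrite mulrN1z.
have fe (i : Iq n) b b' : elts (SDT_inf n) b -> elts (SDT_inf n) b' ->
    (inf_f i b = Some b' <-> inf_e i b' = Some b).
  move=> /SDT_infP oT /SDT_infP oU; split.
    exact: (@inf_op_inv n false).
  exact: (@inf_op_inv n true).
split; last 6 first.
- by move=> b b'; apply: (cl false).
- by move=> b b'; apply: (wtE None).
- by move=> b b'; apply: (wtF None).
- exact: (fe None).
- move=> i b i3 /SDT_infP oT.
  have ap : apart (Some i) None by right.
  by split; [exact: (inf_op_comm true true n1 oT ap)|exact: (inf_op_comm false true n1 oT ap)|
    exact: (inf_op_comm true false n1 oT ap)|exact: (inf_op_comm false false n1 oT ap)].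
- move=> i b b' i3 /SDT_infP oT.
  by apply: (@inf_op_eps_apart n true None i _ _ n1 oT); left.
- split.
  + by move=> i b b'; apply: (cl true (Some i)).
  + by move=> i b b'; apply: (cl false (Some i)).
  + by move=> i b b'; apply: (wtE (Some i)).
  + by move=> i b b'; apply: (wtF (Some i)).
  + move=> i b /SDT_infP oT; have := idx_bounds i => iN.
    rewrite /wti !coord_wt_inf //; try lia.
    have [[sT _] _] := oT; rewrite eps_inf // phi_inf /= /excess; congr Some.
    by have := nsig_diff i b; lia.
  + by move=> i; apply: (fe (Some i)).
  + by move=> i b b' /SDT_infP oT /(@inf_op_eps n true i _ _ n1 oT).
  + by move=> i b b' /SDT_infP oT /(@inf_op_eps n false i _ _ n1 oT).
  + by [].
- by move=> b b'; apply: (cl true).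
Qed.

(** * The direct limit *)

(** Tableaux of shapes lambda and kappa can be compared in the shape
    lambda + kappa, where their rows get the same lengths: there they agree if
    and only if their cores do. *)
Lemma dl_psiP n (la : Lam_t n) T (x : {j : Lam_t n & car (SDT_twist (sval j))}) :
  shaped (sval la) T ->
  @dl_psi n (SDT_system n) la (T, tt) x <->
  is_SDT (sval (tag x)) (tagged x).1 /\ same_core n (tagged x).1 T.
Proof.
move=> shT; case: x => ka [X []] /=; split=> [[[hX _] [m [h [h' [E]]]]]|[hX cX]].
  by split=> //; exact: same_core_add E.
have hl := svalP la; have hk := svalP ka; have shX := SDT_shaped hX.
pose m : Lam_t n := exist _ _ (LamD hl hk).
have h : Lam_le ka m by rewrite /Lam_le /= addrK.
have h' : Lam_le la m by rewrite /Lam_le /= addrC addKr.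
split=> //; exists m, h, h'; rewrite /= /upsilon /m /= addrK; congr (_, _).
rewrite (addrC (sval la)) addrK; apply: (@brow_ext n); rewrite ?size_add_left // => j jn.
rewrite !brow_add_left // (part_brow shT jn) (part_brow shX jn).
have := congr1 size (run_cat_drop j (brow n X j)).
have := congr1 size (run_cat_drop j (brow n T j)).
rewrite [in X in _ -> _ -> X = _](run_cat_drop j (brow n X j)).
rewrite [in X in _ -> _ -> _ = X](run_cat_drop j (brow n T j)).
rewrite -/(core n T j) -/(core n X j) cX // !size_cat !size_nseq => sT sX.
by rewrite !catA -!nseqD sT sX; congr (nseq _ _ ++ _); lia.
Qed.

Lemma dl_psi_eq n (la mu : Lam_t n) T U : shaped (sval la) T -> shaped (sval mu) U ->
  same_core n T U ->
  @dl_psi n (SDT_system n) la (T, tt) = @dl_psi n (SDT_system n) mu (U, tt).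
Proof.
move=> shT shU h; apply/seteqP; split=> x /=.
  move=> /(dl_psiP _ shT)[hx cx]; apply/(dl_psiP _ shU); split=> //.
  exact: same_core_trans cx h.
move=> /(dl_psiP _ shU)[hx cx]; apply/(dl_psiP _ shT); split=> //.
exact: same_core_trans cx (same_core_sym h).
Qed.

Lemma dl_psi_core n (la mu : Lam_t n) T U : is_SDT (sval la) T -> shaped (sval mu) U ->
  @dl_psi n (SDT_system n) la (T, tt) = @dl_psi n (SDT_system n) mu (U, tt) ->
  same_core n T U.
Proof.
move=> hT shU E.
have : @dl_psi n (SDT_system n) la (T, tt) (existT _ la (T, tt)).
  by apply/(dl_psiP _ (SDT_shaped hT)); split.
by rewrite E => /(dl_psiP _ shU)[].
Qed.

(** The initial runs can be prescribed from the bottom row upwards. *)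
Lemma inf_representative n (la : 'rV[int]_n) S : Lam la -> is_SDT la S ->
  exists2 T, dml_filling n T & same_core n T S.
Proof.
move=> hl hS; have [sS bd] := SDT_bounded hl hS.
(* the lengths of the rows, from the bottom *)
pose fix len j := if j is j'.+1 then (len j').+1 + size (core n S j) else 0.
pose T := mkseq (fun r => nseq (len (n - r).-1).+1 (n - r) ++ core n S (n - r)) n.
have sT : size T = n by rewrite size_mkseq.
have rwT j : 0 < j <= n -> brow n T j = nseq (len j.-1).+1 j ++ core n S j.
  by move=> jn; rewrite /brow nth_mkseq ?subKn //; lia.
have runT j : 0 < j <= n -> run j (brow n T j) = (len j.-1).+1.
  by move=> jn; rewrite rwT // run_nseq_cat run_drop addn0.
exists T; last first.
  by move=> j jn; rewrite /core runT // rwT // drop_size_cat ?size_nseq.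
split=> [|j jn]; last first.
  rewrite runT //; case: j jn => [|[|j]] jn //=; first by rewrite brow0.
  by rewrite rwT ?size_cat ?size_nseq //; lia.
split=> // j jn; have bdj := bd j jn; rewrite rwT //; split; last first.
  rewrite all_cat all_nseq; apply/andP; split; first lia.
  by apply/allP => a /mem_drop; exact: (allP bdj).
apply: hook_nseq_cat => //; case: (leqP (size (brow n S j)) (run j (brow n S j))) => rs.
  by left; apply: drop_oversize.
right; split; last first.
  have := nth_run_stop rs; move/(all_nthP 0): bdj => /(_ _ rs).
  by rewrite -nth0 nth_drop addn0; lia.
apply: hook_drop => //; apply: (SDT_hook_brow hl hS) => // E.
by rewrite E in rs.
Qed.

(** The factor T_{-lambda} never gets in the way: its phi_i is -oo, and its
    operators are zero. *)
Lemma twist_eop n s (la : 'rV[int]_n) (i : Iq n) S :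
  (if s then eop (SDT_twist la) i else fop (SDT_twist la) i) (S, tt) =
  omap (fun S' => (S', tt)) (sdt_op s i S).
Proof.
by case: s; case: i => [j|] //=; rewrite /change_e1bar /change_f1bar; case: rd_i => //= b u;
  do !case: eqP => //= _.
Qed.

Definition inf_to_limit n (T : filling) : option (car (direct_limit (SDT_system n))) :=
  if pselect (Lam (sdt_shape n T)) is left h
  then Some (@dl_psi n (SDT_system n) (exist _ _ h) (T, tt)) else None.

Lemma inf_to_limitE n T : dml_filling n T -> exists2 h : Lam (sdt_shape n T),
  inf_to_limit n T = Some (@dl_psi n (SDT_system n) (exist _ _ h) (T, tt)) & shaped (sdt_shape n T) T.
Proof.
move=> oT; have [[sT _] _] := oT; rewrite /inf_to_limit; case: pselect => [h|]; last first.
  by move/(_ (dml_filling_Lam oT)).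
by exists h => //; exact: shaped_shape.
Qed.

Lemma dl_funP n (V : choiceType) (v0 v : V)
    (F : forall j, car (@ds_obj n (SDT_system n) j) -> V) T (h : Lam (sdt_shape n T)) :
  1 < n -> dml_filling n T ->
  (forall (la : Lam_t n) S, is_SDT (sval la) S -> same_core n S T -> F la (S, tt) = v) ->
  dl_fun v0 F (@dl_psi n (SDT_system n) (exist _ _ h) (T, tt)) = v.
Proof.
move=> n1 oT hF; have [[sT _] _] := oT; have sh := shaped_shape sT.
rewrite /dl_fun; case: xgetP => [w _ [la [[S []] [[hS _] E ->]]]|/(_ v) H].
  by apply: hF => //; exact: (@dl_psi_core n la (exist _ _ h) S T hS sh E).
case: H; exists (exist _ _ h), (T, tt); split=> //; first by split=> //; exact: dml_filling_SDT.
by rewrite hF //; exact: dml_filling_SDT.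
Qed.

(** Whichever representative is chosen, its value lies in the class of the value
    at the dual marginally large one, by [sdt_op_core_ex]. *)
Lemma dl_opP n s (i : Iq n) T (h : Lam (sdt_shape n T)) C : 1 < n -> dml_filling n T ->
  @dl_op n (SDT_system n)
    (fun j => if s then eop (@ds_obj n (SDT_system n) j) i
              else fop (@ds_obj n (SDT_system n) j) i)
    (@dl_psi n (SDT_system n) (exist _ _ h) (T, tt)) = Some C ->
  obind (inf_to_limit n) (inf_op s i T) = Some C.
Proof.
move=> n1 oT; have [[sT _] _] := oT; have sh := shaped_shape sT.
rewrite /dl_op; case: xgetP => // v _ [la [[S []] [b' [[hS _] E]]]].
rewrite [X in X = Some b' -> _]twist_eop; case eS: (sdt_op s i S) => [S'|] //= [<-] -> [<-].
have cST := @dl_psi_core n la (exist _ _ h) S T hS sh E; have hl := svalP la.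
have [T' eT cT'] := sdt_op_core_ex n1 (SDT_extensible hl hS i n1) (dml_strictly_extensible i n1 oT) cST eS.
have [U eU [oU cU]] := inf_op_some n1 oT eT.
have [hU psiU shU] := inf_to_limitE oU; rewrite eU /= psiU; congr Some.
apply: dl_psi_eq => //; last exact: same_core_trans cU (same_core_sym cT').
have [sS' shS'] := sdt_op_shape eS; have [sS shS] := SDT_shaped hS.
by split=> [|k kn]; rewrite ?sS' // -shS // /trow shS'.
Qed.

Lemma SDT_inf_limit n : 1 < n ->
  isomorphic (SDT_inf n) (direct_limit (SDT_system n)).
Proof.
move=> n1; exists (inf_to_limit n); split.
  split.
  - move=> T /SDT_infP oT; have [h -> sh] := inf_to_limitE oT.
    by exists (exist _ _ h), (T, tt); split=> //; split=> //; exact: dml_filling_SDT.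
  - move=> T C /SDT_infP oT; have [h -> sh] := inf_to_limitE oT => -[<-].
    by apply: dl_funP => // la S hS cS; have [-> _] := twist_core (SDT_shaped hS) sh cS.
  - move=> i T C /SDT_infP oT; have [h -> sh] := inf_to_limitE oT => -[<-].
    have gT := strictly_extensibleW (dml_strictly_extensible (Some i) n1 oT).
    by split; apply: dl_funP => // la S hS cS;
      have [_ /(_ i (SDT_extensible (svalP la) hS (Some i) n1) gT)[]] := twist_core (SDT_shaped hS) sh cS.
  - move=> i T C /SDT_infP oT; have [h -> sh] := inf_to_limitE oT => -[<-] _.
    case E: (eop _ i _) => [C'|] // _.
    exact: (@dl_opP n true) E.
  - move=> i T C /SDT_infP oT; have [h -> sh] := inf_to_limitE oT => -[<-] _.
    case E: (fop _ i _) => [C'|] // _.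
    exact: (@dl_opP n false) E.
split.
- case=> [T|] //= /SDT_infP oT; have [h -> sh] := inf_to_limitE oT.
  by exists (exist _ _ h), (T, tt); split=> //; split=> //; exact: dml_filling_SDT.
- move=> [T|] [U|] /set_mem /= //.
  + move=> /SDT_infP oT /set_mem /SDT_infP oU.
    have [h -> sh] := inf_to_limitE oT; have [k -> sk] := inf_to_limitE oU => -[E].
    congr Some; apply: (dml_filling_inj oT oU).
    exact: (@dl_psi_core n (exist _ _ h) (exist _ _ k) _ _ (dml_filling_SDT oT) sk E).
  + by move=> /SDT_infP oT _; have [h -> sh] := inf_to_limitE oT.
  + by move=> _ /set_mem /SDT_infP oU; have [h -> sh] := inf_to_limitE oU.
- case=> [C|] /= => [[la [[S []] [[hS _] ->]]]|_]; last by exists None.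
  have [T oT cT] := inf_representative (svalP la) hS.
  exists (Some T); first exact/SDT_infP.
  have [h /= -> sh] := inf_to_limitE oT; congr Some.
  exact: (@dl_psi_eq n (exist _ _ h) la _ _ sh (SDT_shaped hS) cT).
Qed.

Theorem theorem3p14 (n : nat) (hn : 2 <= n) :
  is_q_crystal (SDT_inf n) /\
  isomorphic (SDT_inf n) (direct_limit (SDT_system n)).
Proof. by split; [exact: SDT_inf_crystal|exact: SDT_inf_limit]. Qed.
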